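(* (A) There exists a $\mathscr{U}$-frequently supercyclic operator $T \in \mathscr{L}(c_0(\mathbb{N}) \oplus \mathbb{C})$ that is not frequently supercyclic. (B) There exists a reiteratively supercyclic operator $T \in \mathscr{L}(c_0(\mathbb{N}) \oplus \mathbb{C})$ that is not $\mathscr{U}$-frequently supercyclic. (C) For every $1 \leq p < \infty$, there exists a supercyclic operator $T \in \mathscr{L}(\ell_p(\mathbb{N}) \oplus \mathbb{C})$ that is not reiteratively supercyclic.
   Context: All Banach spaces are complex; $\mathscr{L}(X)$ is the space of bounded linear operators on $X$; $X\oplus\mathbb{C}$ is $X\times\mathbb{C}$ with norm $\|(x,\lambda)\|=\|x\|_X+|\lambda|$. For $E\subset\mathbb{N}_0=\{0,1,2,\dots\}$: lower density $\underline{d}(E)=\liminf_{n\to\infty}\frac{\#(E\cap[0,n])}{n}$; upper density $\overline{d}(E)=\limsup_{n\to\infty}\frac{\#(E\cap[0,n])}{n}$; upper Banach density $\overline{b}(E)=\lim_{s\to\infty}\left[\limsup_{k\to\infty}\frac{\#(E\cap[k+1,k+s])}{s}\right]$. For $T\in\mathscr{L}(X)$, $x\in X$, $U\subset X$, put $\mathcal{N}_T(\mathbb{C}x,U)=\{n\in\mathbb{N}_0: T^n(\mathbb{C}x)\cap U\neq\emptyset\}$, where $\mathbb{C}x=\{\lambda x:\lambda\in\mathbb{C}\}$. $T$ is frequently supercyclic (resp. $\mathscr{U}$-frequently supercyclic, reiteratively supercyclic) if there is $x\in X$ such that for every non-empty open $U\subset X$ the set $\mathcal{N}_T(\mathbb{C}x,U)$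 has positive lower density (resp. positive upper density, positive upper Banach density). $T$ is supercyclic if there is $x\in X$ such that $\{\lambda T^nx:\lambda\in\mathbb{C},n\in\mathbb{N}_0\}$ is dense in $X$. *)

(* Defs.v *)
From HB Require Import structures.
From mathcomp Require Import all_boot all_order all_algebra.
From mathcomp Require Import complex.
From mathcomp Require Import all_classical all_reals all_analysis.

Set Implicit Arguments.
Unset Strict Implicit.
Unset Printing Implicit Defensive.

Import Order.TTheory GRing.Theory Num.Theory.
Import numFieldNormedType.Exports.
Import Normc.

Local Open Scope classical_set_scope.
Local Open Scope ring_scope.
Local Open Scope complex_scope.

(* The norm of a normedModType over R[i] takes its values in R[i], so the
   R-valued norms of the sequence spaces below are embedded by _%:C. *)

Lemma norm_normc (R : realType) (z : R[i]) : `|z| = (normc z)%:C.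
Proof. by []. Qed.

Lemma normc_ge0 (R : realType) (z : R[i]) : 0 <= normc z.
Proof. by rewrite -lecR -norm_normc normr_ge0. Qed.

Section direct_sum.
Context {K : numFieldType}.

(* X * Y already carries the max norm, hence the alias. *)
Definition l1sum (X Y : normedModType K) : Type := (X * Y)%type.

Context {X Y : normedModType K}.

HB.instance Definition _ := GRing.Lmodule.copy (l1sum X Y) (X * Y)%type.

Definition l1sum_norm (z : l1sum X Y) : K := `|z.1| + `|z.2|.

Lemma l1sum_normD z w : l1sum_norm (z + w) <= l1sum_norm z + l1sum_norm w.
Proof. by rewrite /l1sum_norm addrACA lerD// ler_normD. Qed.

Lemma l1sum_normZ (a : K) z : l1sum_norm (a *: z) = `|a| * l1sum_norm z.
Proof. by rewrite /l1sum_norm !normrZ mulrDr. Qed.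

Lemma l1sum_norm0_eq0 z : l1sum_norm z = 0 -> z = 0.
Proof.
case: z => x y /eqP; rewrite paddr_eq0// !normr_eq0 => /andP[/eqP/= -> /eqP ->].
by [].
Qed.

HB.instance Definition _ := Lmodule_isNormed.Build K (l1sum X Y)
  l1sum_normD l1sum_normZ l1sum_norm0_eq0.

End direct_sum.

Section c0.
Context {R : realType}.
Local Notation C := R[i].

Definition c0_pred : pred (nat -> C) :=
  fun x => `[< (x : nat -> C^o) n @[n --> \oo] --> (0 : C^o) >].

Lemma c0_submod_closed : submod_closed c0_pred.
Proof.
split => [|a x y]; rewrite !unfold_in.
  by apply/asboolP; exact: (@cvg_cst C^o).
move=> /asboolP x0 /asboolP y0; apply/asboolP.
have h := cvgD (cvgZl_tmp (k := a) x0) y0.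
by rewrite scaler0 addr0 in h; exact: h.
Qed.

HB.instance Definition _ :=
  GRing.isSubmodClosed.Build C (nat -> C) c0_pred c0_submod_closed.

Record c0 := C0 { c0_seq :> nat -> C ; _ : c0_pred c0_seq }.

HB.instance Definition _ := [isSub for c0_seq].
HB.instance Definition _ := [Choice of c0 by <:].
HB.instance Definition _ := [SubChoice_isSubLmodule of c0 by <:].

Definition c0_norm (x : c0) : C := (sup (range (fun n => normc (x n))))%:C.

Lemma c0P (x : c0) : (x : nat -> C^o) n @[n --> \oo] --> (0 : C^o).
Proof. by case: x => x /= /asboolP. Qed.

Lemma c0_has_sup (x : c0) : has_sup (range (fun n => normc (x n))).
Proof.
split; first by exists (normc (x 0%N)), 0%N.
have [N _ xN] : \forall n \near \oo, `|x n| < 1.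
  by have /cvgr0Pnorm_lt := c0P x; apply.
exists (1 + \sum_(i < N) normc (x i)) => _ [n _ <-].
have [nN|Nn] := ltnP n N.
  rewrite (bigD1 (Ordinal nN))//= addrCA lerDl addr_ge0// sumr_ge0// => i _.
  exact: normc_ge0.
rewrite (@le_trans _ _ 1)//; last first.
  by rewrite lerDl sumr_ge0// => i _; exact: normc_ge0.
by rewrite -lecR ltW//; exact: xN.
Qed.

Lemma normc_le_c0 (x : c0) n : normc (x n) <= sup (range (fun n => normc (x n))).
Proof.
by apply: ub_le_sup; [exact: (c0_has_sup x).2|exists n].
Qed.

Lemma c0_normD x y : c0_norm (x + y) <= c0_norm x + c0_norm y.
Proof.
rewrite /c0_norm -rmorphD/= lecR; apply: ge_sup; first exact: (c0_has_sup (x + y)).1.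
move=> _ [n _ <-].
by rewrite (le_trans (le_normcD (x n) (y n)))// lerD// normc_le_c0.
Qed.

Lemma c0_normZ (a : C) x : c0_norm (a *: x) = `|a| * c0_norm x.
Proof.
rewrite /c0_norm norm_normc -rmorphM/=; congr (_%:C).
have le1 b y :
    sup (range (fun n => normc ((b *: y : c0) n))) <=
    normc b * sup (range (fun n => normc ((y : c0) n))).
  apply: ge_sup; first exact: (c0_has_sup (b *: y)).1.
  move=> _ [n _ <-].
  by rewrite [leLHS](normcM b (y n)) ler_wpM2l ?normc_ge0// normc_le_c0.
apply/eqP; rewrite eq_le le1/=.
have [->|a0] := eqVneq a 0.
  rewrite normc0 mul0r.
  exact: le_trans (normc_ge0 _) (normc_le_c0 (0 *: x) 0%N).
have na0 : 0 < normc a by rewrite -ltcR -norm_normc normr_gt0.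
rewrite -ler_pdivlMl//.
by have := le1 a^-1 (a *: x); rewrite scalerA mulVf// scale1r normcV.
Qed.

Lemma c0_norm0_eq0 x : c0_norm x = 0 -> x = 0.
Proof.
move=> /complexI x0; apply/val_inj/funext => n.
by apply: eq0_normc; apply/eqP; rewrite eq_le normc_ge0 -x0 normc_le_c0.
Qed.

HB.instance Definition _ := Lmodule_isNormed.Build C c0
  c0_normD c0_normZ c0_norm0_eq0.

End c0.
Arguments c0 : clear implicits.

Section lp.
Context {R : realType} {p : R} (p1 : 1 <= p).
Local Notation C := R[i].

Definition lp_enorm (x : nat -> C) : \bar R :=
  ((\sum_(n <oo) ((normc (x n)) `^ p)%:E) `^ p^-1)%E.

(* The proof of 1 <= p is an argument of lp_pred and lp only so that the
   submodule and normed module instances can be inferred. *)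
Definition lp_pred & 1 <= p : pred (nat -> C) :=
  fun x => (\sum_(n <oo) ((normc (x n)) `^ p)%:E < +oo)%E.

Let p0 : 0 < p. Proof. exact: lt_le_trans p1. Qed.

Lemma lp_sum_ge0 (x : nat -> C) :
  (0 <= \sum_(n <oo) ((normc (x n)) `^ p)%:E)%E.
Proof. by apply: nneseries_ge0 => n _ _; rewrite lee_fin powR_ge0. Qed.

Lemma lp_enorm_ge0 (x : nat -> C) : (0 <= lp_enorm x)%E.
Proof. exact: poweR_ge0. Qed.

Lemma lp_enorm_lty (x : nat -> C) : (lp_enorm x < +oo)%E = lp_pred p1 x.
Proof.
apply/idP/idP => [|h]; last exact: poweR_lty.
rewrite /lp_enorm /lp_pred; case: (\sum_(_ <oo) _)%E => [r| |]//=.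
- by rewrite !ltry.
- by rewrite invr_eq0 gt_eqF.
Qed.

Lemma lp_enormE (x : nat -> C) :
  lp_enorm x = 'N[counting]_p%:E[EFin \o (fun n => normc (x n))]%E.
Proof.
rewrite Lnorm_counting// /lp_enorm; congr (_ `^ _)%E.
apply: eq_eseriesr => n _ /=.
by rewrite ger0_norm ?normc_ge0.
Qed.

Lemma lp_enormD (x y : nat -> C) :
  (lp_enorm (x + y)%R <= lp_enorm x + lp_enorm y)%E.
Proof.
have mf (z : nat -> C) : measurable_fun [set: nat] (fun n => normc (z n)) by [].
rewrite !lp_enormE.
apply: le_trans (minkowski_EFin (@counting nat R) (mf x) (mf y) p1).
rewrite !Lnorm_counting//; apply: gt0_ler_poweR.
- by rewrite invr_ge0 ltW.
- by rewrite in_itv/= leey andbT nneseries_ge0// => n _ _; exact: poweR_ge0.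
- by rewrite in_itv/= leey andbT nneseries_ge0// => n _ _; exact: poweR_ge0.
apply: lee_nneseries => n _ /=; first by rewrite lee_fin powR_ge0.
rewrite lee_fin ge0_ler_powR// ?nnegrE//; first exact: ltW.
rewrite !ger0_norm ?addr_ge0 ?normc_ge0//.
exact: le_normcD.
Qed.

Lemma lp_enormZ (a : C) (x : nat -> C) :
  lp_enorm (a *: x) = ((normc a)%:E * lp_enorm x)%E.
Proof.
have a0 := normc_ge0 a.
rewrite /lp_enorm; under eq_eseriesr => n _.
  rewrite (_ : (a *: x) n = a * x n)// normcM powRM ?normc_ge0// EFinM.
  over.
rewrite nneseriesZl; last by move=> n _; rewrite lee_fin powR_ge0.
rewrite poweRM ?lp_sum_ge0// ?lee_fin ?powR_ge0//.
by rewrite poweR_EFin -powRrM mulfV ?gt_eqF// powRr1.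
Qed.

Lemma lp_submod_closed : submod_closed (lp_pred p1).
Proof.
have E x : (x \in lp_pred p1) = (lp_enorm x < +oo)%E by rewrite lp_enorm_lty.
split => [|a x y]; rewrite !E.
  by have := lp_enormZ 0 0; rewrite scale0r normc0 mul0e => ->.
move=> xoo yoo; apply: le_lt_trans (lp_enormD _ _) _.
by rewrite lte_add_pinfty// lp_enormZ lte_mul_pinfty ?lee_fin ?normc_ge0.
Qed.

HB.instance Definition _ :=
  GRing.isSubmodClosed.Build C (nat -> C) (lp_pred p1) lp_submod_closed.

Record lp := Lp { lp_seq :> nat -> C ; _ : lp_pred p1 lp_seq }.

HB.instance Definition _ := [isSub for lp_seq].
HB.instance Definition _ := [Choice of lp by <:].
HB.instance Definition _ := [SubChoice_isSubLmodule of lp by <:].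

Definition lp_norm (x : lp) : C := (fine (lp_enorm x))%:C.

Lemma lp_enorm_fin_num (x : lp) : lp_enorm x \is a fin_num.
Proof.
rewrite ge0_fin_numE ?lp_enorm_ge0// lp_enorm_lty.
exact: (valP x).
Qed.

Lemma lp_normD x y : lp_norm (x + y) <= lp_norm x + lp_norm y.
Proof.
rewrite /lp_norm -rmorphD/= lecR -fineD ?lp_enorm_fin_num//.
apply: fine_le; rewrite ?fin_numD ?lp_enorm_fin_num//.
  exact: (lp_enorm_fin_num (x + y)).
exact: (lp_enormD x y).
Qed.

Lemma lp_normZ (a : C) x : lp_norm (a *: x) = `|a| * lp_norm x.
Proof.
rewrite /lp_norm norm_normc -rmorphM/=; congr (_%:C).
by rewrite [X in fine X](lp_enormZ a x) fineM ?lp_enorm_fin_num.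
Qed.

Lemma lp_norm0_eq0 x : lp_norm x = 0 -> x = 0.
Proof.
move=> /complexI x0; apply/val_inj/funext => n /=.
have /eqP : lp_enorm x = 0 by rewrite -(fineK (lp_enorm_fin_num x)) x0.
rewrite poweR_eq0 ?lp_sum_ge0// => /andP[/eqP s0 _].
have : (((normc (x n)) `^ p)%:E <= 0)%E.
  rewrite -s0 (@nneseriesD1 _ _ n)//; last first.
    by move=> k _; rewrite lee_fin powR_ge0.
  by rewrite leeDl// nneseries_ge0// => k _ _; rewrite lee_fin powR_ge0.
rewrite lee_fin => xn0; apply: eq0_normc; apply: (@powR_eq0_eq0 _ _ p).
by apply/eqP; rewrite eq_le xn0 powR_ge0.
Qed.

HB.instance Definition _ := Lmodule_isNormed.Build C lp
  lp_normD lp_normZ lp_norm0_eq0.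

End lp.

Section density.
Context {R : realType}.
Local Open Scope ereal_scope.

(* The number of elements of E in [m, n[: the upper bound is excluded. *)
Definition count_in (E : set nat) (m n : nat) : nat :=
  (\sum_(m <= i < n | i \in E) 1)%N.

Definition lower_density (E : set nat) : \bar R :=
  limn_einf (fun n => ((count_in E 0 n.+1)%:R / n%:R)%:E).

Definition upper_density (E : set nat) : \bar R :=
  limn_esup (fun n => ((count_in E 0 n.+1)%:R / n%:R)%:E).

(* The outer limit exists for every E: the limsup over k of the number of
   elements of E in [k + 1, k + s] is subadditive in s. *)
Definition upper_banach_density (E : set nat) : \bar R :=
  limn (fun s : nat => limn_esup (fun k : nat =>
    ((count_in E k.+1 (k + s).+1)%:R / s%:R)%:E)).

End density.
Arguments lower_density R E : clear implicits.
Arguments upper_density R E : clear implicits.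
Arguments upper_banach_density R E : clear implicits.

Section operators.
Context {R : realType} {X : normedModType R[i]}.
Implicit Types (T : X -> X) (x : X) (U : set X).

Definition bounded_operator (T : {linear X -> X}) :=
  exists M : R, forall x, `|T x| <= M%:C * `|x|.

Definition cline x : set X := [set l *: x | l in [set: R[i]]].

Definition return_times T x U : set nat :=
  [set n | (iter n T @` cline x) `&` U !=set0].

Definition frequently_supercyclic T :=
  exists x, forall U, open U -> U !=set0 ->
    (0 < lower_density R (return_times T x U))%E.

Definition U_frequently_supercyclic T :=
  exists x, forall U, open U -> U !=set0 ->
    (0 < upper_density R (return_times T x U))%E.

Definition reiteratively_supercyclic T :=
  exists x, forall U, open U -> U !=set0 ->
    (0 < upper_banach_density R (return_times T x U))%E.

Definition supercyclic T :=
  exists x, dense [set l *: iter n T x | l in [set: R[i]] & n in [set: nat]].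

End operators.

(* Main.v *)
Require Import Defs.
From HB Require Import structures.
From mathcomp Require Import all_boot all_order all_algebra.
From mathcomp Require Import complex.
From mathcomp Require Import all_classical all_reals all_analysis.
From mathcomp Require Import zify ring lra.
Set Implicit Arguments.
Unset Strict Implicit.
Unset Printing Implicit Defensive.
Import Order.TTheory GRing.Theory Num.Theory.
Import numFieldNormedType.Exports.
Import Normc.
Local Open Scope classical_set_scope.
Local Open Scope ring_scope.
Local Open Scope complex_scope.

(** Each operator is T = B (+) id, where B is a weighted backward shift on the
    sequence space. Write its weights as quotients, (B x) n = W(n+1)/W(n) * x(n+1)
    with W(0) = 1, so that (B^k x)(n) = W(n+k)/W(n) * x(n+k); B is bounded as soon
    as W(n+1) <= 2 W(n). The second coordinate is fixed by T, so
    T^n (x, c) is c times (B^n (x/c), 1), and the line through it comes close to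
    (y, 1) exactly when B^n (x/c) comes close to y. Hence the three recurrence
    notions for the lines C(x, c) under T become the
    corresponding notions for orbits of B (sum_id_return_coordinate,
    return_times_target). The scalars in the definition of supercyclicity thereby
    lose their effect, and it is enough to choose W well.

    Obstruction on c_0. For suitable U, a return time n of C(x, c) to U satisfies
    |c| < W(n) |x(n)|; as x(n) tends to 0, W tends to infinity along the return
    times. So if the sets {W >= 2^r} have upper (lower) density tending to 0 as r
    grows, the return times cannot have positive upper (lower) density.

    Construction on c_0. W = 2^height, and the vector (c0_seed) carries, on an
    interval [start i, stop i), copies of a finite word repeated with period 2^r,
    the pair (r, word) running infinitely often through all possibilities. At a
    time n = start i + c 2^r the orbit shows the word, followed by later copies
    divided by W. Two features of W make these small. Near multiples of 2^r the
    height is about r (dyadic_height), which handles the copies in the same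
    block; such positions have density O(2^-r). And the height is at least j on
    all of [start j - prev_stop j, stop j) (ramp), which handles the copies in a
    later block j, for every earlier time n <= prev_stop j. Before each ramp lies
    an empty stretch i times as long as everything that precedes it. If the
    blocks are as long as the distance from 0 to their start, return times have
    positive upper density, whereas {W >= 2^r} has small proportion at the ends
    of the empty stretches: T is U-frequently but not frequently supercyclic. If
    block i has length i+1, return times have positive upper Banach density,
    whereas {W >= 2^r} has upper density O(2^-r): T is reiteratively but not
    U-frequently supercyclic.

    On l_p take W(n)^p = sqrt(n+1). As W is unbounded and increasing, a vector made
    of words placed very far apart has a dense orbit. For a set of return times
    E, if n and n+j lie in E then |(B^n x)(j)| > |c| / W(j) while
    ||B^n x|| < K |c|; summing p-th powers over n+j in E with j < s gives
    #(E /\ [n, n+s)) <= K^p sqrt(s+1), which is o(s). So E has zero upper Banach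
    density. *)

(** * Counting and the dyadic height *)

Section counting.
Local Open Scope nat_scope.
Implicit Types (E : set nat) (P : pred nat).

Lemma count_in_cat E m n p : (m <= n)%N -> (n <= p)%N ->
  count_in E m p = (count_in E m n + count_in E n p)%N.
Proof. exact: big_cat_nat. Qed.

Lemma count_in_le E m n : (count_in E m n <= n - m)%N.
Proof.
rewrite /count_in big_mkcond -[X in (_ <= X)%N]muln1 -sum_nat_const_nat.
by apply: leq_sum => i _; case: ifP.
Qed.

Lemma count_inE E m n : count_in E m n = \sum_(m <= i < n) (i \in E : nat).
Proof. by rewrite /count_in big_mkcond; apply: eq_bigr => i _; case: ifP. Qed.

Lemma count_in_sub E F m n : (forall i, m <= i < n -> E i -> F i) ->
  count_in E m n <= count_in F m n.
Proof.
move=> EF; rewrite !count_inE !big_nat; apply: leq_sum => i /EF {}EF.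
case: (boolP (i \in E)) => // /set_mem /EF Fi.
by rewrite mem_set.
Qed.

Lemma count_inU E F m n :
  count_in (E `|` F) m n <= count_in E m n + count_in F m n.
Proof.
rewrite !count_inE -big_split; apply: leq_sum => i _ /=.
by rewrite in_setU; case: (i \in E); case: (i \in F).
Qed.

Lemma count_in_set0 E m n : (forall i, m <= i < n -> ~ E i) -> count_in E m n = 0.
Proof.
move=> E0; rewrite count_inE big_nat big1// => i /E0 Ei.
by rewrite memNset.
Qed.

(** Cut [a, a + m) into windows of length q: each begins with a term of the
    progression. In product form the bound needs no rounding. *)
Lemma count_in_progression E a q m : 0 < q ->
  (forall c, c * q < m -> E (a + c * q)) -> m <= q * count_in E a (a + m).
Proof.
move=> q0; elim/ltn_ind: m a => m IH a Em.
have [m0|m_gt0] := posnP m; first by rewrite m0.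
have Ea : 0 < count_in E a (a + minn q m).
  rewrite count_inE big_ltn; last by lia.
  by rewrite mem_set//; have := Em 0; rewrite addn0; apply.
rewrite (@count_in_cat _ _ (a + minn q m)); [|lia|lia].
rewrite mulnDr; move: Ea; have [mq|qm] := leqP m q => Ea.
  by rewrite (leq_trans mq)// (leq_trans _ (leq_addr _ _))// leq_pmulr.
have := IH (m - q) _ (a + q); rewrite -addnA subnKC ?(ltnW qm)// => {}IH.
have {}IH : m - q <= q * count_in E (a + q) (a + m).
  apply: IH; first by lia.
  move=> c cm; rewrite -addnA -mulSn; apply: Em.
  by rewrite mulSn; lia.
by rewrite -{1}(subnKC (ltnW qm)) leq_add// leq_pmulr.
Qed.

Definition positive_multiple q i := (0 < i) && (q %| i).

Lemma sum_positive_multiple q N : 0 < q ->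
  \sum_(0 <= i < N) positive_multiple q i <= N %/ q.
Proof.
move=> q0; suff : \sum_(0 <= i < N.+1) positive_multiple q i <= N %/ q.
  by apply: leq_trans; rewrite big_nat_recr//= leq_addr.
elim: N => [|N IH]; first by rewrite big_nat1.
rewrite big_nat_recr//= divnS// addnC.
exact: leq_add.
Qed.

Lemma sum_positive_multiple_addr q N d : 0 < q ->
  \sum_(0 <= i < N) positive_multiple q (i + d) <= (N + d) %/ q.
Proof.
move=> q0; apply: leq_trans (sum_positive_multiple (N + d) q0).
rewrite [X in _ <= X](@big_cat_nat _ _ _ d) ?leq_addl//=.
have -> : \sum_(d <= i < N + d) positive_multiple q i =
    \sum_(0 <= i < N) positive_multiple q (i + d).
  by rewrite -{1}(add0n d) big_addn addnK.
by rewrite leq_addl.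
Qed.

Lemma sum_positive_multiple_subr q N d : 0 < q ->
  \sum_(0 <= i < N) positive_multiple q (i - d) <= N %/ q.
Proof.
move=> q0; elim: d => [|d IH].
  by under eq_bigr do rewrite subn0; exact: sum_positive_multiple.
apply: leq_trans IH; case: N => [|N]; first by rewrite !big_geq.
rewrite big_nat_recl// sub0n add0n big_nat_recr//=.
by rewrite (leq_trans _ (leq_addr _ _)).
Qed.

(** Halving M first gives the recursion S(M) = M + S(M %/ 2), hence the geometric
    bound without leaving the natural numbers. *)
Lemma sum_divn_exp2 M D : \sum_(0 <= d < D) M %/ 2 ^ d <= M.*2.
Proof.
elim: D M => [|D IH] M; first by rewrite big_geq.
rewrite big_nat_recl// divn1 -addnn leq_add2l.
under eq_bigr do rewrite expnS divnMA.
by apply: (leq_trans (IH _)); lia.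
Qed.

(** The smallest 1-Lipschitz function above the 2-adic valuation: the supremum
    over m of logn 2 m - |m - n|, written with m = n + d and m = n - d. The
    truncation d <= n loses nothing, since logn 2 m is at most |m - n| for
    m > 2 n. *)
Definition dyadic_height n :=
  \max_(d < n.+1) maxn (logn 2 (n + d) - d) (logn 2 (n - d) - d).

Lemma leq_dyadic_height n d : d <= n ->
  maxn (logn 2 (n + d) - d) (logn 2 (n - d) - d) <= dyadic_height n.
Proof.
move=> dn.
exact: (@leq_bigmax _ (fun d : 'I_n.+1 => maxn (logn 2 (n + d) - d) (logn 2 (n - d) - d))
  (Ordinal (dn : d < n.+1))).
Qed.

(** The term of index d at n.+1 is, up to 1, the term of index d.+1 or d.-1 at n.
    Indices out of range are handled by size: n.+1 + d <= 2 d + 1 < 2 ^ d.+1. *)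
Lemma dyadic_height_step n : dyadic_height n.+1 <= (dyadic_height n).+1.
Proof.
apply/bigmax_leqP => -[d /= dn] _; rewrite geq_max; apply/andP; split.
  have [dn'|nd] := ltnP d n.
    have := leq_dyadic_height dn'; rewrite geq_max => /andP[+ _].
    by rewrite addSnnS; lia.
  have : 2 ^ logn 2 (n.+1 + d) < 2 ^ d.+1.
    apply: (@leq_ltn_trans (n.+1 + d)); first by rewrite dvdn_leq// pfactor_dvdnn.
    by have := ltn_expl d (isT : 1 < 2); rewrite expnS; lia.
  by rewrite ltn_exp2l//; lia.
case: d dn => [_|d]; last first.
  rewrite ltnS => dn; have := @leq_dyadic_height n d dn.
  by rewrite geq_max => /andP[_]; rewrite subSS; lia.
case: n => // n; have := @leq_dyadic_height n.+1 1 isT.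
by rewrite geq_max => /andP[+ _]; rewrite !subn0 addn1; lia.
Qed.

Lemma dyadic_height_ge c r k : 0 < c -> r - k <= dyadic_height (c * 2 ^ r + k).
Proof.
move=> c0; apply: (leq_trans _ (leq_dyadic_height (leq_addl (c * 2 ^ r) k))).
rewrite leq_max; apply/orP; right; rewrite addnK leq_sub2r//.
by rewrite lognM ?expn_gt0// pfactorK// leq_addl.
Qed.

(** A height of at least r at n forces 2 ^ (r + d) to divide n + d or n - d for
    some d; these conditions have densities summing to O(2 ^- r). *)
Lemma dyadic_height_count r N : 0 < r ->
  2 ^ r * count_in [set n | r <= dyadic_height n] 0 N <= 8 * N.
Proof.
move=> r0; pose q d := 2 ^ (r + d).
have q_gt0 d : 0 < q d by rewrite expn_gt0.
have logq m d : r <= logn 2 m - d -> positive_multiple (q d) m.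
  move=> rm; apply/andP; split; first by case: m rm => //; rewrite logn0; lia.
  by rewrite /q pfactor_dvdn; [lia| |case: m rm => //; rewrite logn0; lia].
have : count_in [set n | r <= dyadic_height n] 0 N <=
    \sum_(0 <= n < N) \sum_(0 <= d < N)
      (positive_multiple (q d) (n + d) + positive_multiple (q d) (n - d)).
  rewrite count_inE !big_nat; apply: leq_sum => n /= nN.
  case: (boolP (n \in _)) => // /set_mem /= rn.
  have [d dn rd] : exists2 d, d <= n &
      r <= maxn (logn 2 (n + d) - d) (logn 2 (n - d) - d).
    move: rn; rewrite /dyadic_height.
    have [|d ->] := @bigop.eq_bigmax _ (fun d : 'I_n.+1 =>
      maxn (logn 2 (n + d) - d) (logn 2 (n - d) - d)); first by rewrite card_ord.
    by exists d => //; rewrite -ltnS.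
  rewrite (@big_cat_nat _ _ _ d)//=; last by rewrite ltnW// (leq_ltn_trans dn).
  rewrite [X in _ + X]big_ltn ?(leq_ltn_trans dn)// addnCA.
  apply: (leq_trans _ (leq_addr _ _)).
  by move: rd; rewrite leq_max => /orP[] /logq ->//; rewrite ltn_addl.
rewrite exchange_big /= => le_count.
rewrite (@leq_trans (2 ^ r * \sum_(0 <= d < N) 2 * ((2 * N) %/ q d)))//.
  rewrite leq_mul2l; apply/orP; right; apply: (leq_trans le_count).
  rewrite !big_nat; apply: leq_sum => d /= dN.
  rewrite big_split mul2n -addnn leq_add//=.
    apply: leq_trans (sum_positive_multiple_addr _ _ (q_gt0 d)) _.
    by rewrite leq_div2r//; lia.
  apply: leq_trans (sum_positive_multiple_subr _ _ (q_gt0 d)) _.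
  by rewrite leq_div2r//; lia.
rewrite big_distrr (@leq_trans (\sum_(0 <= d < N) 2 * ((2 * N) %/ 2 ^ d)))//.
  apply: leq_sum => d _ /=; rewrite mulnCA leq_mul2l /=.
  by rewrite /q addnC expnD divnMA mulnC leq_trunc_div.
rewrite -big_distrr /=.
have := sum_divn_exp2 (2 * N) N; lia.
Qed.

End counting.

(** * Density criteria *)

Section density_criteria.
Context {R : realType}.
Implicit Types (u : nat -> R) (E : set nat).
Local Open Scope ereal_scope.

Lemma ereal_gt0_real (x : \bar R) : 0 < x -> exists2 d : R, (0 < d)%R & d%:E < x.
Proof.
case: x => [x| |]//; last by exists 1%R => //; rewrite ltry.
by rewrite lte_fin => x0; exists (x / 2)%R; rewrite ?lte_fin ?divr_gt0//; lra.
Qed.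

Lemma limn_esup_gt0 u : 0 < limn_esup (EFin \o u) ->
  exists2 d : R, (0 < d)%R & forall N, exists2 n, (N <= n)%N & (d <= u n)%R.
Proof.
move=> /ereal_gt0_real[d d0 du]; exists d => // N.
have : d%:E < ereal_sup ((EFin \o u) @` [set n | (N <= n)%N]).
  apply: (lt_le_trans du); apply: ereal_inf_lbound.
  by exists [set n | (N <= n)%N] => //; exists N.
by move=> /ereal_sup_gt[_ [n /= Nn <-]]; rewrite lte_fin => /ltW; exists n.
Qed.

Lemma le_limn_esup u (d : R) :
  (forall N, exists2 n, (N <= n)%N & (d <= u n)%R) ->
  d%:E <= limn_esup (EFin \o u).
Proof.
move=> du; apply: le_ereal_inf_tmp => _ [V [N _ NV] <-].
have [n Nn dn] := du N.
apply: (@le_trans _ _ (u n)%:E); first by rewrite lee_fin.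
by apply: ereal_sup_ubound; exists n => //; exact: NV.
Qed.

Lemma limn_esup_le u (d : R) N :
  (forall n, (N <= n)%N -> (u n <= d)%R) -> limn_esup (EFin \o u) <= d%:E.
Proof.
move=> ud; apply: (@le_trans _ _ (ereal_sup ((EFin \o u) @` [set n | (N <= n)%N]))).
  apply: ereal_inf_lbound.
  by exists [set n | (N <= n)%N] => //; exists N.
by apply: ge_ereal_sup => _ [n /= Nn <-]; rewrite lee_fin ud.
Qed.

Lemma limn_einf_gt0 u : 0 < limn_einf (EFin \o u) ->
  exists2 d : R, (0 < d)%R & exists N, forall n, (N <= n)%N -> (d <= u n)%R.
Proof.
move=> /ereal_gt0_real[d d0]; rewrite /limn_einf lteNr => du; exists d => //.
have [_ [V [N _ NV] <-] Vd] := ereal_inf_lt du.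
exists N => n Nn; rewrite -lee_fin -leeN2; apply/ltW/(le_lt_trans _ Vd).
by apply: ereal_sup_ubound; exists n => //; exact: NV.
Qed.

Lemma upper_density_gt0 E : 0 < upper_density R E ->
  exists2 d : R, (0 < d)%R & forall N, exists2 n, (N <= n)%N &
    (d * n%:R <= (count_in E 0 n.+1)%:R)%R.
Proof.
move=> /limn_esup_gt0[d d0 du]; exists d => // N.
have [n Nn dn] := du N.+1; exists n; first exact: ltnW.
by rewrite -ler_pdivlMr// ltr0n; case: n Nn dn.
Qed.

Lemma upper_density_gt0W E (d : R) : (0 < d)%R ->
  (forall N, exists2 n, (N <= n)%N & (d * n%:R <= (count_in E 0 n.+1)%:R)%R) ->
  0 < upper_density R E.
Proof.
move=> d0 dE; apply: (@lt_le_trans _ _ d%:E); first by rewrite lte_fin.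
apply: le_limn_esup => N; have [n Nn dn] := dE N.+1.
exists n; first exact: ltnW.
by rewrite ler_pdivlMr// ltr0n; case: n Nn dn.
Qed.

Lemma lower_density_gt0 E : 0 < lower_density R E ->
  exists2 d : R, (0 < d)%R & exists N, forall n, (N <= n)%N ->
    (d * n%:R <= (count_in E 0 n.+1)%:R)%R.
Proof.
move=> /limn_einf_gt0[d d0 [N dN]]; exists d => //; exists N.+1 => n Nn.
rewrite -ler_pdivlMr; first exact/dN/ltnW.
by rewrite ltr0n; case: n Nn.
Qed.

Definition window_count E s k := count_in E k.+1 (k + s).+1.

(** c is at most the limsup in k of the integers [window_count E s k]. The maximal
    such c, [max_count], is that limsup: working with an integer gives both an
    eventual upper bound and infinitely many windows attaining it. *)
Definition recurrent_count E s c :=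
  `[< (c <= s)%N /\ forall N, exists2 k, (N <= k)%N & (c <= window_count E s k)%N >].

Lemma recurrent_count0 E s : exists c, recurrent_count E s c.
Proof. by exists 0%N; apply/asboolP; split=> // N; exists N. Qed.

Lemma recurrent_count_le E s c : recurrent_count E s c -> (c <= s)%N.
Proof. by move=> /asboolP[]. Qed.

Definition max_count E s : nat :=
  ex_maxn (recurrent_count0 E s) (@recurrent_count_le E s).

Lemma max_count_le E s : (max_count E s <= s)%N.
Proof. by rewrite /max_count; case: ex_maxnP => c /recurrent_count_le. Qed.

Lemma max_count_recurrent E s N :
  exists2 k, (N <= k)%N & (max_count E s <= window_count E s k)%N.
Proof. by rewrite /max_count; case: ex_maxnP => c /asboolP[_ +] _; apply. Qed.

Lemma max_count_eventual E s :
  exists N, forall k, (N <= k)%N -> (window_count E s k <= max_count E s)%N.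
Proof.
rewrite /max_count; case: ex_maxnP => c _ cmax; apply: contrapT => noN.
suff : recurrent_count E s c.+1 by move=> /cmax; rewrite ltnn.
have rec N : exists2 k, (N <= k)%N & (c < window_count E s k)%N.
  apply: contrapT => nok; apply: noN; exists N => k Nk.
  by rewrite leqNgt; apply/negP => ck; apply: nok; exists k.
apply/asboolP; split => //; have [k _] := rec 0%N.
by move=> /leq_trans; apply; apply: leq_trans (count_in_le _ _ _) _; lia.
Qed.

(** A window of length s + t splits into two consecutive windows, each subject to
    its eventual bound. *)
Lemma max_countD E s t : (max_count E (s + t) <= max_count E s + max_count E t)%N.
Proof.
have [N1 le1] := max_count_eventual E s.
have [N2 le2] := max_count_eventual E t.
have [k Nk /leq_trans] := max_count_recurrent E (s + t) (N1 + N2).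
apply; rewrite /window_count (@count_in_cat _ _ (k + s).+1) ?leq_add2l//; try lia.
apply: leq_add; first by apply: le1; lia.
by rewrite addnA; apply: le2; lia.
Qed.

Lemma max_countM E q m r : (max_count E (q * m + r) <= q * max_count E m + r)%N.
Proof.
elim: q => [|q IH]; first by rewrite !mul0n !add0n max_count_le.
by rewrite !mulSn -!addnA (leq_trans (max_countD _ _ _))// leq_add2l.
Qed.

Definition banach_density E : R :=
  inf (range (fun s => (max_count E s.+1)%:R / s.+1%:R))%R.

Lemma banach_density_le E s : (banach_density E * s%:R <= (max_count E s)%:R)%R.
Proof.
case: s => [|s]; first by rewrite mulr0.
rewrite -ler_pdivlMr//; apply: ge_inf; last by exists s.
by exists 0%R => _ [t _ <-].
Qed.

(** Fekete's subadditive lemma: take a window length whose quotient is close to the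
    infimum and divide s by it; the remainder costs at most that fixed length,
    negligible as s grows. *)
Lemma max_count_cvg E :
  (fun s => (max_count E s)%:R / s%:R : R)%R @ \oo --> banach_density E.
Proof.
apply/cvgrPdist_le => /= e e0.
have [_ [m _ <-]] : exists2 x, range (fun s => (max_count E s.+1)%:R / s.+1%:R : R)%R x
    & (x < banach_density E + e / 2)%R.
  apply: inf_adherent; first exact: divr_gt0.
  split; first by exists ((max_count E 1)%:R / 1)%R, 0%N.
  by exists 0%R => _ [t _ <-].
set g := max_count E m.+1 => gm.
near=> s.
have s0 : (0 < s%:R :> R)%R by rewrite ltr0n; near: s; exists 1%N.
rewrite distrC ger0_norm; last first.
  by rewrite subr_ge0 ler_pdivlMr// banach_density_le.
rewrite lerBlDl ler_pdivrMr//.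
have := max_countM E (s %/ m.+1) m.+1 (s %% m.+1).
rewrite -divn_eq -/g => gs.
have {gs} gs : ((max_count E s)%:R <= (s %/ m.+1)%:R * g%:R + m.+1%:R :> R)%R.
  rewrite -natrM -natrD ler_nat (leq_trans gs)// leq_add2l ltnW//.
  by rewrite ltn_mod.
apply: (le_trans gs).
have h1 : ((s %/ m.+1)%:R * g%:R <= (banach_density E + e / 2) * s%:R :> R)%R.
  apply: (@le_trans _ _ ((s %/ m.+1)%:R * ((banach_density E + e / 2) * m.+1%:R))%R).
    by rewrite ler_wpM2l// -ler_pdivrMr// ltW.
  rewrite mulrCA ler_wpM2l//; last by rewrite -natrM ler_nat leq_trunc_div.
  by apply: le_trans (ltW gm); exact: divr_ge0.
have h2 : (m.+1%:R <= e / 2 * s%:R :> R)%R.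
  rewrite -ler_pdivrMl ?divr_gt0//.
  by near: s; exact: nbhs_infty_ger.
by rewrite (le_trans (lerD h1 h2))// -mulrDl; lra.
Unshelve. all: by end_near. Qed.

Lemma upper_banach_densityE E : upper_banach_density R E = (banach_density E)%:E.
Proof.
rewrite /upper_banach_density; apply/cvg_lim => //.
rewrite [X in X @ _ --> _](_ : _ = EFin \o (fun s => (max_count E s)%:R / s%:R)%R).
  by apply: cvg_EFin; [exact: nearW|exact: max_count_cvg].
apply/funext => s /=; apply/eqP; rewrite eq_le; apply/andP; split.
  have [N maxN] := max_count_eventual E s.
  apply: (@limn_esup_le _ _ N) => k /maxN Nk.
  by rewrite ler_wpM2r ?invr_ge0 ?ler_nat.
apply: le_limn_esup => N; have [k Nk maxk] := max_count_recurrent E s N.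
by exists k => //; rewrite ler_wpM2r ?invr_ge0 ?ler_nat.
Qed.

Lemma upper_banach_density_gt0 E : 0 < upper_banach_density R E ->
  exists2 d : R, (0 < d)%R & forall s, exists k,
    (d * s%:R <= (window_count E s k)%:R)%R.
Proof.
rewrite upper_banach_densityE lte_fin => d0; exists (banach_density E) => // s.
have [k _ sk] := max_count_recurrent E s 0.
by exists k; rewrite (le_trans (banach_density_le _ _))// ler_nat.
Qed.

Lemma upper_banach_density_gt0W E (d : R) : (0 < d)%R ->
  (forall s N, exists2 k, (N <= k)%N & (d * s.+1%:R <= (window_count E s.+1 k)%:R)%R) ->
  0 < upper_banach_density R E.
Proof.
move=> d0 dE; rewrite upper_banach_densityE lte_fin (lt_le_trans d0)//.
apply: lb_le_inf; first by exists ((max_count E 1)%:R / 1)%R, 0%N.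
move=> _ [s _ <-]; rewrite ler_pdivlMr//.
have [N maxN] := max_count_eventual E s.+1.
by have [k /maxN Nk /le_trans] := dE s N; apply; rewrite ler_nat.
Qed.

End density_criteria.

(** * The direct sum with the identity *)

Section sum_identity.
Context {R : realType} {X : normedModType R[i]}.
Local Notation Y := (l1sum X R[i]^o).

Definition sum_id (B : X -> X) (z : Y) : Y := (B z.1, z.2).

Lemma sum_id_linear (B : {linear X -> X}) : linear (sum_id B).
Proof. by move=> a x y; rewrite /sum_id linearP. Qed.

HB.instance Definition _ (B : {linear X -> X}) :=
  GRing.isLinear.Build R[i] Y Y _ (sum_id B) (sum_id_linear B).

Lemma iter_sum_id B n (z : Y) : iter n (sum_id B) z = (iter n B z.1, z.2).
Proof. by elim: n => [|n IH]; [case: z|rewrite /= IH]. Qed.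

Lemma bounded_sum_id (B : {linear X -> X}) (M : R) : 1 <= M ->
  (forall x, `|B x| <= M%:C * `|x|) -> bounded_operator (sum_id B).
Proof.
move=> M1 BM; exists M => -[x l].
have -> : `|(x, l) : Y| = `|x| + `|l| by [].
rewrite mulrDr [leLHS](_ : _ = `|B x| + `|l|)//.
by rewrite lerD// ler_peMl// -[1]/(1%:C) lecR.
Qed.

Lemma return_times_sum_id (B : {linear X -> X}) (z : Y) (U : set Y) n :
  return_times (sum_id B) z U n <-> exists l : R[i], U (l *: iter n B z.1, l * z.2).
Proof.
have iterZ l x : iter n B (l *: x) = l *: iter n B x.
  by elim: n => //= n ->; rewrite linearZ.
split=> [[_ [[_ [l _ <-] <-] Ulz]]|[l Ul]].
  by exists l; rewrite iter_sum_id iterZ in Ulz; exact: Ulz.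
exists (l *: iter n B z.1, l * z.2); split=> //.
exists (l *: z); first by exists l.
by rewrite iter_sum_id iterZ.
Qed.

(** An open set contains a point whose last coordinate l is nonzero; dividing by l
    describes a neighbourhood of it by a ball around y in X alone. *)
Lemma open_sum_ball (U : set Y) : open U -> U !=set0 ->
  exists (l : R[i]) (y : X) (e : R), 0 < e /\
    forall y', `|y - y'| < e%:C -> U (l *: y', l).
Proof.
move=> oU [[y0 l0] Uz].
have Unb : nbhs ((y0, l0) : Y) U by apply: open_nbhs_nbhs; split.
have /nbhs_ballP[e0 /= e0_gt0 eU] := Unb.
pose e := complex.Re e0 / 3.
have e0E : e0 = (complex.Re e0)%:C by rewrite RRe_real// gtr0_real.
have e_gt0 : 0 < e by rewrite divr_gt0// -ltcR -e0E.
pose l : R[i] := if l0 == 0 then e%:C else l0.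
have l_neq0 : l != 0.
  rewrite /l; case: ifPn => // _.
  by rewrite gt_eqF// ltcR.
have ll0 : `|l0 - l| <= e%:C.
  rewrite /l; case: ifPn => [/eqP->|_].
    by rewrite sub0r normrN ger0_norm// lecR ltW.
  by rewrite subrr normr0 lecR ltW.
have nl_gt0 : 0 < normc l by rewrite -ltcR -norm_normc normr_gt0.
exists l, (l^-1 *: y0), (e / normc l); split; first exact: divr_gt0.
move=> y' yy'; apply: eU.
rewrite -ball_normE/= [X in X < _](_ : _ = `|y0 - l *: y'| + `|l0 - l|)//.
have -> : y0 - l *: y' = l *: (l^-1 *: y0 - y').
  by rewrite scalerBr scalerA divff// scale1r.
rewrite normrZ e0E (@lt_le_trans _ _ (e%:C + e%:C))//.
  apply: ltr_leD => //.
  by rewrite norm_normc mulrC -ltr_pdivlMr ?ltcR// -fmorph_div.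
by rewrite -rmorphD/= lecR; move: e_gt0; rewrite /e; lra.
Qed.

End sum_identity.

(** * Blocks and ramps *)

Section blocks.
Local Open Scope nat_scope.
Context (a b : nat -> nat).
Context (ab : forall i, a i < b i).
Context (ba : forall i, b i <= a i.+1).

(** The index of the first block that ends after x. Searching up to x suffices
    because i < b i. *)
Definition block x := find (fun i => x < b i) (iota 0 x.+1).

Lemma block_end_mono i j : i <= j -> b i <= b j.
Proof.
move=> /subnK <-; elim: (j - i) => // k; rewrite addSn => /leq_trans; apply.
by rewrite (leq_trans (ba _))// ltnW.
Qed.

Lemma block_end_gt i : i < b i.
Proof. by elim: i => [|i IH]; [exact: leq_ltn_trans (ab 0)|have := ab i.+1; have := ba i; lia]. Qed.

Lemma block_lt x : x < b (block x).
Proof.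
have xb : has (fun i => x < b i) (iota 0 x.+1).
  by apply/hasP; exists x; rewrite ?mem_iota ?block_end_gt//= ltnSn.
have := nth_find 0 xb; rewrite nth_iota// -[X in _ < X](size_iota 0).
by rewrite -has_find.
Qed.

Lemma block_le x i : x < b i -> block x <= i.
Proof.
move=> xi; rewrite leqNgt; apply/negP => ix.
have ix' : i < x.+1.
  by rewrite (leq_trans ix)// -[X in _ <= X](size_iota 0) find_size.
by have := before_find 0 ix; rewrite nth_iota// add0n xi.
Qed.

Lemma blockE i x : a i <= x -> x < b i -> block x = i.
Proof.
move=> aix xbi; apply/eqP; rewrite eqn_leq block_le//=.
rewrite leqNgt; apply/negP => xi.
have := block_lt x; rewrite ltnNge => /negP; apply.
apply: leq_trans aix; case: i xbi xi => // i _; rewrite ltnS => xi.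
by rewrite (leq_trans (block_end_mono xi)).
Qed.

Lemma block_mono x y : x <= y -> block x <= block y.
Proof. by move=> xy; apply/block_le/(leq_ltn_trans xy)/block_lt. Qed.

Section ramp.
Context (A : nat -> nat).
Context (bA : forall i, b i <= A i.+1).
Context (Ab : forall i, A i <= b i).

(** Zero up to the foot A i of the current block, then of slope one until the
    block ends; the truncated subtraction produces the zero part. The abrupt drop
    at the end of a block is harmless, as only increases are to be bounded. *)
Definition ramp x := x - A (block x).

Lemma ramp_base_mono i j : i <= j -> A i <= A j.
Proof.
move=> /subnK <-; elim: (j - i) => // k; rewrite addSn => /leq_trans; apply.
by rewrite (leq_trans (Ab _)).
Qed.

(** When x.+1 enters a new block, that block's foot lies at or after the end b of
    the previous one, so the ramp restarts at 0. *)
Lemma ramp_step x : ramp x.+1 <= (ramp x).+1.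
Proof.
rewrite /ramp; have := block_mono (leqnSn x); rewrite leq_eqVlt => /orP[/eqP <-|lt].
  by lia.
have /block_end_mono/leq_trans/(_ (bA _)) : block x <= (block x.+1).-1 by lia.
rewrite prednK; last by lia.
by have := block_lt x; lia.
Qed.

Lemma ramp_ge i x : x < b i -> x - A i <= ramp x.
Proof. by move=> xb; rewrite leq_sub2l// ramp_base_mono// block_le. Qed.

Lemma ramp_eq0 i x : b i <= x -> x <= A i.+1 -> ramp x = 0.
Proof.
move=> bx xA; apply/eqP; rewrite subn_eq0 (leq_trans xA)// ramp_base_mono//.
rewrite ltnNge; apply/negP => xi.
by have := leq_trans (block_lt x) (block_end_mono xi); lia.
Qed.

Lemma ramp_eq0_start x : x <= A 0 -> ramp x = 0.
Proof. by move=> xA; apply/eqP; rewrite subn_eq0 (leq_trans xA)// ramp_base_mono. Qed.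

End ramp.

End blocks.

Section towers.
Local Open Scope nat_scope.
Context (len : nat -> nat -> nat).
Context (len_gt0 : forall i m, 0 < len i m).

(** The end of block i.-1, with the value 1 at i = 0. The formulas of lead, start
    and stop below appear expanded here, as the recursion has to be structural. *)
Fixpoint prev_stop i :=
  if i is j.+1 then
    let m := j.+1 * prev_stop j + prev_stop j + j in m + len j m
  else 1.

(** The factor i.+1 makes everything before the foot of ramp i negligible. The
    distance prev_stop i + i from foot to start lets a time y <= prev_stop i be
    subtracted from a position of block i while keeping height i
    ([height_block]). *)
Definition lead i := i.+1 * prev_stop i.
Definition start i := lead i + prev_stop i + i.
Definition stop i := start i + len i (start i).

Lemma prev_stopS i : prev_stop i.+1 = stop i.
Proof. by []. Qed.

Lemma prev_stop_gt i : i < prev_stop i.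
Proof. by elim: i => // i; rewrite prev_stopS /stop /start; have := len_gt0 i (start i); rewrite /start; lia. Qed.

Lemma start_lt_stop i : start i < stop i.
Proof. by rewrite /stop; have := len_gt0 i (start i); lia. Qed.

Lemma prev_stop_le_lead i : prev_stop i <= lead i.
Proof. by rewrite /lead mulSn leq_addr. Qed.

Lemma lead_le_start i : lead i <= start i.
Proof. by rewrite /start; lia. Qed.

Lemma stop_le_lead i : stop i <= lead i.+1.
Proof. by rewrite -prev_stopS prev_stop_le_lead. Qed.

Lemma lead_le_stop i : lead i <= stop i.
Proof. by rewrite (leq_trans (lead_le_start i))// ltnW// start_lt_stop. Qed.

Lemma stop_le_start i : stop i <= start i.+1.
Proof. exact: leq_trans (stop_le_lead i) (lead_le_start _). Qed.

Lemma prev_stop_mono i j : i <= j -> prev_stop i <= prev_stop j.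
Proof.
move=> /subnK <-; elim: (j - i) => // k; rewrite addSn => /leq_trans; apply.
exact: leq_trans (prev_stop_le_lead _) (lead_le_stop _).
Qed.

Definition height x := maxn (dyadic_height x) (ramp stop lead x).

Lemma height_step x : height x.+1 <= (height x).+1.
Proof.
rewrite /height geq_max; apply/andP; split.
  by rewrite (leq_trans (dyadic_height_step x))// ltnS leq_maxl.
rewrite (leq_trans (ramp_step start_lt_stop stop_le_start stop_le_lead x))//.
by rewrite ltnS leq_maxr.
Qed.

Lemma height_dyadic c r k : 0 < c -> r - k <= height (c * 2 ^ r + k).
Proof. by move=> c0; rewrite leq_max dyadic_height_ge. Qed.

(** After a shift by y <= prev_stop i, the positions of block i still lie at least
    i steps up ramp i. *)
Lemma height_block i x y : y <= prev_stop i -> y + x < stop i ->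
  start i <= y + x -> i <= height x.
Proof.
move=> yi xi ix; rewrite leq_max; apply/orP; right.
have xs : x < stop i by apply: leq_ltn_trans xi; rewrite leq_addl.
apply: leq_trans (ramp_ge stop_le_lead lead_le_stop xs).
by move: ix; rewrite /start; lia.
Qed.

Lemma count_height r n : 0 < r ->
  count_in [set x | r <= height x] 0 n <=
  count_in [set x | r <= dyadic_height x] 0 n + count_in [set x | 0 < ramp stop lead x] 0 n.
Proof.
move=> r0; apply: leq_trans (count_inU _ _ _ _); apply: count_in_sub => x _ /=.
by rewrite leq_max => /orP[]; [left|right; exact: leq_trans r0 _].
Qed.

(** The ramp vanishes on [prev_stop i, lead i). *)
Lemma count_ramp_lead i : count_in [set x | 0 < ramp stop lead x] 0 (lead i) <= prev_stop i.
Proof.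
rewrite (@count_in_cat _ _ (prev_stop i)) ?prev_stop_le_lead//.
rewrite [X in _ + X]count_in_set0 ?addn0; last first.
  move=> x /andP[ix xi] /=; case: i ix xi => [_ /ltnW xi|i ix /ltnW xi].
    by rewrite (ramp_eq0_start stop_le_lead lead_le_stop xi).
  by rewrite (ramp_eq0 start_lt_stop stop_le_start stop_le_lead lead_le_stop ix xi).
by rewrite (leq_trans (count_in_le _ _ _))// subn0.
Qed.

(** Up to lead i.+1 the ramp is positive only before prev_stop i and on
    [lead i, stop i), whose lengths are comparable to prev_stop i = lead i / i.+1
    when blocks are short. *)
Lemma count_ramp_short i n : (forall j m, len j m = j.+1) ->
  lead i <= n -> n <= lead i.+1 ->
  i.+1 * count_in [set x | 0 < ramp stop lead x] 0 n <= 4 * n.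
Proof.
move=> lenE li nl.
have le4 : count_in [set x | 0 < ramp stop lead x] 0 n <= 4 * prev_stop i.
  have [ns|sn] := leqP n (stop i).
    rewrite (@count_in_cat _ _ (lead i))//.
    have := count_ramp_lead i; have := count_in_le [set x | 0 < ramp stop lead x] (lead i) n.
    move: ns; rewrite /stop /start lenE; have := prev_stop_gt i; lia.
  rewrite (count_in_cat _ (leq0n (stop i)) (ltnW sn)) [X in _ + X]count_in_set0.
    rewrite addn0.
    have := count_ramp_lead i; have := count_in_le [set x | 0 < ramp stop lead x] (lead i) (stop i).
    rewrite (count_in_cat _ (leq0n (lead i)) (lead_le_stop i)).
    rewrite /stop /start lenE; have := prev_stop_gt i; lia.
  move=> x /andP[ix /leq_trans/(_ nl)/ltnW xi] /=.
  by rewrite (ramp_eq0 start_lt_stop stop_le_start stop_le_lead lead_le_stop ix xi).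
apply: (@leq_trans (i.+1 * (4 * prev_stop i))); first by rewrite leq_mul2l le4 orbT.
by rewrite mulnCA leq_mul2l.
Qed.

End towers.
(* Unfolding the recursion would hide prev_stop i.+1 = stop i. *)
Arguments prev_stop : simpl never.

(** * Return times of the direct sum *)

Section real_norm.
Context {R : realType} {V : normedModType R[i]}.
Implicit Types x y : V.

(** The norm of a complex normed space takes its values in R[i]. *)
Definition rnorm x : R := complex.Re `|x|.

Lemma rnormE x : `|x| = (rnorm x)%:C.
Proof. by rewrite RRe_real// ger0_real. Qed.

Lemma rnorm_ge0 x : 0 <= rnorm x.
Proof. by rewrite -lecR -rnormE; exact: normr_ge0. Qed.

Lemma ler_rnormD x y : rnorm (x + y) <= rnorm x + rnorm y.
Proof. by rewrite -lecR rmorphD/= -!rnormE ler_normD. Qed.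

Lemma rnormN x : rnorm (- x) = rnorm x.
Proof. by rewrite /rnorm normrN. Qed.

Lemma rnormZ (a : R[i]) x : rnorm (a *: x) = normc a * rnorm x.
Proof. by apply: complexI; rewrite rmorphM/= -!rnormE normrZ norm_normc. Qed.

Lemma rnormB x y : rnorm (x - y) = rnorm (y - x).
Proof. by rewrite -rnormN opprB. Qed.

Lemma rnorm_triangle x y z : rnorm (x - z) <= rnorm (x - y) + rnorm (y - z).
Proof. by rewrite -[x - z](subrKA y) ler_rnormD. Qed.

Lemma open_lipschitz_lt0 (f : V -> R) (L : R) : 0 < L ->
  (forall x y, f y - f x <= L * rnorm (x - y)) -> open [set x | f x < 0].
Proof.
move=> L0 fL; rewrite openE => x /= fx.
apply/nbhs_ballP; exists (- f x / L)%:C => /=; first by rewrite ltcR divr_gt0// oppr_gt0.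
move=> y; rewrite -ball_normE /= rnormE ltcR ltr_pdivlMr// => xy.
by have := fL x y; rewrite mulrC; lra.
Qed.

End real_norm.

Section normc_extra.
Context {R : realType}.
Implicit Types a b : R[i].

Lemma normcN a : normc (- a) = normc a.
Proof. by apply: complexI; rewrite -!norm_normc normrN. Qed.

Lemma normcB a b : normc (a - b) = normc (b - a).
Proof. by rewrite -normcN opprB. Qed.

Lemma ler_normc_add a b : normc a <= normc b + normc (a - b).
Proof. by rewrite -[X in normc X <= _](subrK b) addrC le_normcD. Qed.

Lemma normc_real (r : R) : normc r%:C = `|r|.
Proof. by apply: complexI; rewrite -norm_normc normc_def/= expr0n/= addr0 sqrtr_sqr. Qed.

End normc_extra.

Section sum_identity_shift.
Context {R : realType} {X : normedModType R[i]}.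
Local Notation Y := (l1sum X R[i]^o).
Context (cf : X -> nat -> R[i]) (B : {linear X -> X}).
Context (cfB : forall x y n, cf (x - y) n = cf x n - cf y n).
Context (cfZ : forall a x n, cf (a *: x) n = a * cf x n).
Context (cf_le : forall x n, normc (cf x n) <= rnorm x).

Lemma rnorm_sum (z : Y) : rnorm z = rnorm z.1 + normc z.2.
Proof. by apply: complexI; rewrite rmorphD/= -!rnormE. Qed.

(** The set U consists of the (y, l) with |l| < |y 0| and |y| < K |l|; the
    inequalities are homogeneous, so the scalar of the orbit line cancels. *)
Lemma sum_id_return_coordinate y : 1 < normc (cf y 0) ->
  exists (K : R) (U : set Y), [/\ open U, U !=set0 & forall (z : Y) n,
    return_times (sum_id B) z U n ->
    normc z.2 < normc (cf (iter n B z.1) 0) /\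
    rnorm (iter n B z.1) < K * normc z.2].
Proof.
move=> y1; pose K := 1 + rnorm y.
have K0 : 0 < K by rewrite ltr_wpDr ?rnorm_ge0.
pose f (z : Y) := normc z.2 - normc (cf z.1 0).
pose g (z : Y) := rnorm z.1 - K * normc z.2.
exists K, ([set z | f z < 0] `&` [set z | g z < 0]); split.
- apply: openI.
    apply: (@open_lipschitz_lt0 _ _ _ 1) => // z w.
    rewrite mul1r rnorm_sum /f.
    have := ler_normc_add w.2 z.2; have := ler_normc_add (cf z.1 0) (cf w.1 0).
    rewrite -cfB; have := cf_le (z.1 - w.1) 0; rewrite (normcB w.2) /=; lra.
  apply: (@open_lipschitz_lt0 _ _ _ (1 + K)); first by rewrite addr_gt0.
  move=> z w; rewrite rnorm_sum /g.
  have h1 := ler_rnormD (w.1 - z.1) z.1; rewrite subrK rnormB in h1.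
  have h2 : K * normc z.2 <= K * normc w.2 + K * normc (z.2 - w.2).
    by rewrite -mulrDr ler_wpM2l ?ler_normc_add// ltW.
  have := normc_ge0 (z.2 - w.2); have := rnorm_ge0 (z.1 - w.1).
  have : 0 <= K * rnorm (z.1 - w.1) by rewrite mulr_ge0 ?rnorm_ge0// ltW.
  have -> : (1 + K) * (rnorm (z.1 - w.1) + normc (z.2 - w.2)) =
      rnorm (z.1 - w.1) + normc (z.2 - w.2) +
      (K * rnorm (z.1 - w.1) + K * normc (z.2 - w.2)) by ring.
  by lra.
- have n1 : normc (1 : R[i]^o) = 1 := normc1 R.
  exists (y, 1); split.
    by rewrite /mkset /f n1 subr_lt0.
  by rewrite /mkset /g n1 /K; lra.
- move=> [x c] n /return_times_sum_id[l []] /=.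
  rewrite /f /g /= rnormZ cfZ !normcM !subr_lt0 => h1 h2.
  have l0 : 0 < normc l.
    rewrite lt_neqAle normc_ge0 andbT; apply/eqP => l0.
    by rewrite -l0 !mul0r ltxx in h1.
  by split; [rewrite -(ltr_pM2l l0)|rewrite -(ltr_pM2l l0) mulrCA].
Qed.

(** Since the last coordinate stays 1, returning to U amounts to B^n x returning to
    a ball, whose centre may be taken in the dense family D. *)
Lemma return_times_target (D : seq (rat * rat) -> X) (x : X) (U : set Y) :
  (forall y (e : R), 0 < e -> exists s, rnorm (y - D s) < e) ->
  open U -> U !=set0 ->
  exists s (e : R), 0 < e /\ forall n, rnorm (iter n B x - D s) < e ->
    return_times (sum_id B) (x, 1) U n.
Proof.
move=> dD oU U0; have [l [y [e [e0 eU]]]] := open_sum_ball oU U0.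
have [s ys] := dD y (e / 2) (divr_gt0 e0 (ltr0n _ 2)).
exists s, (e / 2); split; first exact: divr_gt0.
move=> n ns; apply/return_times_sum_id; exists l => /=; rewrite mulr1.
apply: eU; rewrite rnormE ltcR (le_lt_trans (rnorm_triangle _ (D s) _))//.
by rewrite (rnormB (D s)); lra.
Qed.

Lemma iter_shift (W : nat -> R) : (forall n, 0 < W n) ->
  (forall x n, cf (B x) n = (W n.+1 / W n)%:C * cf x n.+1) ->
  forall k x n, cf (iter k B x) n = (W (n + k)%N / W n)%:C * cf x (n + k)%N.
Proof.
move=> W0 BW; elim=> [|k IH] x n.
  by rewrite addn0 divff ?mul1r// gt_eqF.
rewrite iterS BW IH mulrA -rmorphM/= addSnnS; congr (_%:C * _).
by rewrite mulrC mulrA divfK// gt_eqF.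
Qed.

End sum_identity_shift.

(** * Enumeration of the targets *)

Section targets.
Context {R : realType}.

Definition rat_complex (q : rat * rat) : R[i] := ratr q.1 +i* ratr q.2.

Lemma normc_le_ReIm (a b : R) : normc (a +i* b) <= `|a| + `|b|.
Proof.
rewrite -(ger0_norm (addr_ge0 (normr_ge0 a) (normr_ge0 b))) -sqrtr_sqr.
rewrite ler_wsqrtr// -(real_normK (num_real a)) -(real_normK (num_real b)).
by have := mulr_ge0 (normr_ge0 a) (normr_ge0 b); rewrite sqrrD; lra.
Qed.

Lemma rat_approx (x e : R) : 0 < e -> exists q, `|x - ratr q| < e.
Proof.
move=> e0; have [q] := @rat_in_itvoo R (x - e) (x + e) ltac:(lra).
by rewrite in_itv/= => /andP[qx xq]; exists q; rewrite ltr_norml; apply/andP; split; lra.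
Qed.

Lemma rat_complex_dense (z : R[i]) (e : R) : 0 < e ->
  exists q, normc (z - rat_complex q) < e.
Proof.
move=> e0; have e2 : 0 < e / 2 by rewrite divr_gt0.
case: z => x y; have [q xq] := rat_approx x e2; have [r yr] := rat_approx y e2.
exists (q, r); apply: (@le_lt_trans _ _ (`|x - ratr q| + `|y - ratr r|)); last by lra.
exact: normc_le_ReIm.
Qed.

Definition letter (s : seq (rat * rat)) k : R[i] := nth 0 (map rat_complex s) k.

Definition fits i (s : seq (rat * rat)) :=
  (size s <= i)%N && all (fun q => normc (rat_complex q) <= i%:R) s.

(** The period exponent and the word assigned to block i. The first component of
    the decoded triple only serves to bring up each pair infinitely often; a word
    with entries or length above i is skipped, which bounds block i by i. *)
Definition task i : nat * seq (rat * rat) :=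
  if (unpickle i : option (nat * (nat * seq (rat * rat)))) is Some (_, (r, s)) then
    if fits i s then (r, s) else (0%N, [::])
  else (0%N, [::]).

Lemma task_fits i : fits i (task i).2.
Proof. by rewrite /task; case: unpickle => // -[_ [r s]]; case: ifP. Qed.

Lemma letter_fits i s k : fits i s -> normc (letter s k) <= i%:R.
Proof.
move=> /andP[_ /allP si]; rewrite /letter.
have [ks|sk] := ltnP k (size s); last by rewrite nth_default ?size_map// normc0.
by rewrite (nth_map (0, 0))// si// mem_nth.
Qed.

Lemma letter_default s k : (size s <= k)%N -> letter s k = 0.
Proof. by move=> sk; rewrite /letter nth_default ?size_map. Qed.

Lemma fits_eventually s : exists N, forall i, (N <= i)%N -> fits i s.
Proof.
elim: s => [|q s [N sN]]; first by exists 0%N.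
exists (N + (Num.truncn (normc (rat_complex q))).+1).+1 => i Ni.
have /andP[si alls] : fits i s by apply: sN; lia.
apply/andP; split => /=; last first.
  rewrite alls andbT ltW// (lt_le_trans (truncnS_gt _))// ler_nat; exact: leq_trans (leqW (leq_addl _ _)) Ni.
have /andP[] : fits i.-1 s by apply: sN; lia.
by lia.
Qed.

Lemma injective_unbounded (f : nat -> nat) M : injective f -> exists m, (M <= f m)%N.
Proof.
move=> finj; apply: contrapT => noM.
have : (size (map f (iota 0 M.+1)) <= size (iota 0 M))%N.
  apply: uniq_leq_size; first by rewrite map_inj_uniq ?iota_uniq.
  move=> _ /mapP[m _ ->]; rewrite mem_iota/= add0n ltnNge; apply/negP => Mm.
  by apply: noM; exists m.
by rewrite size_map !size_iota ltnn.
Qed.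

Lemma task_recurrent r s N : exists2 i, (N <= i)%N & task i = (r, s).
Proof.
have [M sM] := fits_eventually s.
have [|m Mm] := @injective_unbounded (fun m => pickle (m, (r, s))) (M + N).
  by move=> m m' /(pcan_inj pickleK)[].
exists (pickle (m, (r, s))); first by lia.
by rewrite /task pickleK sM//; lia.
Qed.

End targets.

(** * Weighted shifts on c_0 *)

Section words.
Context {R : realType}.
Implicit Types (W : nat -> R) (s : seq (rat * rat)).

(** Vectors are described by their coordinates multiplied by W: in these
    coordinates B is the plain shift. *)
Definition word W s k : R[i] := ((W k)^-1)%:C * letter s k.

Lemma normc_scale (w : R) (a : R[i]) : 0 < w -> normc (w%:C * a) = w * normc a.
Proof. by move=> w0; rewrite normcM normc_real gtr0_norm. Qed.

Lemma word_default W s k : (size s <= k)%N -> word W s k = 0.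
Proof. by move=> sk; rewrite /word letter_default// mulr0. Qed.

Lemma word_approx W (y : nat -> R[i]) (e : R) N : (forall n, 1 <= W n) -> 0 < e ->
  exists s, size s = N /\ forall k, (k < N)%N -> normc (y k - word W s k) <= e.
Proof.
move=> W1 e0.
have [q qP] := choice (fun k => rat_complex_dense ((W k)%:C * y k) e0).
exists (mkseq q N); split; first by rewrite size_mkseq.
move=> k kN; have W0 : 0 < W k := lt_le_trans ltr01 (W1 k).
rewrite /word /letter (nth_map (0, 0)) ?size_mkseq// nth_mkseq//.
have -> : y k = ((W k)^-1)%:C * ((W k)%:C * y k).
  by rewrite mulrA -rmorphM/= mulVf ?mul1r// gt_eqF.
rewrite -mulrBr normc_scale ?invr_gt0// ler_pdivrMl//.
by rewrite (le_trans (ltW (qP k)))// ler_peMl// ltW.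
Qed.

End words.

Section c0_facts.
Context {R : realType}.
Implicit Types (x y : c0 R) (W : nat -> R).

Lemma rnorm_c0 x : rnorm x = sup (range (fun n => normc (x n))).
Proof. by []. Qed.

Lemma normc_le_rnorm_c0 x n : normc (x n) <= rnorm x.
Proof. exact: normc_le_c0. Qed.

Lemma rnorm_c0_le x (e : R) : (forall n, normc (x n) <= e) -> rnorm x <= e.
Proof.
move=> xe; rewrite rnorm_c0; apply: ge_sup; first exact: (c0_has_sup x).1.
by move=> _ [n _ <-].
Qed.

Lemma c0_predP (x : nat -> R[i]) :
  c0_pred x <-> forall e : R, 0 < e -> exists N, forall n, (N <= n)%N -> normc (x n) <= e.
Proof.
split=> [/asboolP x0 e e0|xe].
  have [N _ xN] : \forall n \near \oo, `|(x n : R[i]^o)| < e%:C.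
    by have /cvgr0Pnorm_lt := x0; apply; rewrite ltcR.
  by exists N => n /xN; rewrite norm_normc ltcR => /ltW.
apply/asboolP; apply/cvgr0Pnorm_le => e e0.
have eE : e = (complex.Re e)%:C by rewrite RRe_real// gtr0_real.
have e2 : 0 < complex.Re e by rewrite -ltcR -eE.
have [N xN] := xe _ e2.
exists N => // n /= /xN xn.
suff : (normc (x n))%:C <= (complex.Re e)%:C by rewrite -eE.
by rewrite lecR.
Qed.

Lemma c0_shift W (M : R) : (forall n, 0 < W n) -> 
  (forall n, W n.+1 <= M * W n) ->
  exists2 B : {linear c0 R -> c0 R},
    (forall x n, B x n = (W n.+1 / W n)%:C * x n.+1) &
    (forall x, `|B x| <= M%:C * `|x|).
Proof.
move=> W0 WM.
have M0 : 0 < M by rewrite -(pmulr_lgt0 _ (W0 0%N)) (lt_le_trans (W0 1%N)).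
have le1 x n : normc ((W n.+1 / W n)%:C * x n.+1) <= M * normc (x n.+1).
  rewrite normc_scale ?divr_gt0// ler_wpM2r ?normc_ge0//.
  by rewrite ler_pdivrMr.
have Bp x : c0_pred (fun n => (W n.+1 / W n)%:C * x n.+1).
  have /c0_predP xe : c0_pred x by case: x.
  apply/c0_predP => e e0; have [N xN] := xe (e / M) (divr_gt0 e0 M0).
  exists N => n Nn; apply: (le_trans (le1 x n)).
  by rewrite -ler_pdivlMl// mulrC xN// ltnW.
pose f x : c0 R := C0 (Bp x).
have f_linear : linear f.
  move=> a x y; apply/val_inj/funext => n.
  by rewrite /= [LHS]mulrDr; congr (_ + _); rewrite /= mulrCA.
pose fL := GRing.isLinear.Build R[i] (c0 R) (c0 R) _ f f_linear.
pose B : {linear c0 R -> c0 R} := HB.pack f fL.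
exists B => // x; rewrite !rnormE -rmorphM/= lecR.
apply: rnorm_c0_le => n; apply: (le_trans (le1 x n)).
by rewrite ler_wpM2l ?normc_le_rnorm_c0// ltW.
Qed.

Lemma word_c0_pred W s : c0_pred (word W s).
Proof.
apply/c0_predP => e e0; exists (size s) => n sn.
by rewrite word_default// normc0 ltW.
Qed.

Definition word_c0 W s : c0 R := C0 (word_c0_pred W s).

Lemma word_c0_dense W : (forall n, 1 <= W n) ->
  forall y (e : R), 0 < e -> exists s, rnorm (y - word_c0 W s) < e.
Proof.
move=> W1 y e e0; have e2 : 0 < e / 2 by rewrite divr_gt0.
have /c0_predP/(_ _ e2)[N yN] : c0_pred y by case: y.
have [s [sN ys]] := word_approx y N W1 e2.
exists s; apply: (@le_lt_trans _ _ (e / 2)); last by lra.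
apply: rnorm_c0_le => n; rewrite [X in normc X](_ : _ = y n - word W s n)//.
have [nN|Nn] := ltnP n N; first exact: ys.
by rewrite word_default ?sN// subr0 yN.
Qed.

End c0_facts.

(** * The operators on c_0 *)

Section layout.
Context {R : realType} (len : nat -> nat -> nat).
Context (len_gt0 : forall i m, (0 < len i m)%N).

Definition layout (w : nat -> nat -> R[i]) x : R[i] :=
  let i := block (stop len) x in
  if (start len i <= x)%N then w i (x - start len i)%N else 0.

Lemma layoutE w i x : (start len i <= x)%N -> (x < stop len i)%N ->
  layout w x = w i (x - start len i)%N.
Proof.
move=> ix xi; rewrite /layout.
by rewrite (blockE (start_lt_stop len_gt0) (stop_le_start len) ix xi) ix.
Qed.

Lemma layout_gap w i x : (prev_stop len i <= x)%N -> (x < start len i)%N ->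
  layout w x = 0.
Proof.
move=> ix xi; rewrite /layout.
have prev_lt j : (prev_stop len j < stop len j)%N.
  exact: leq_ltn_trans (leq_trans (prev_stop_le_lead _ _) (lead_le_start _ _))
    (start_lt_stop len_gt0 j).
have stop_prev j : (stop len j <= prev_stop len j.+1)%N by rewrite prev_stopS.
have xs : (x < stop len i)%N by exact: ltn_trans xi (start_lt_stop len_gt0 i).
by rewrite (blockE prev_lt stop_prev ix xs) leqNgt xi.
Qed.

End layout.

Section c0_operator.
Context {R : realType} (len : nat -> nat -> nat).
Context (len_gt0 : forall i m, (0 < len i m)%N).
Local Notation start := (start len).
Local Notation stop := (stop len).
Local Notation prev_stop := (prev_stop len).
Local Notation height := (height len).

Definition weight n : R := 2 ^+ height n.

Lemma weight_gt0 n : 0 < weight n. Proof. exact: exprn_gt0. Qed.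
Lemma weight_ge1 n : 1 <= weight n. Proof. by rewrite exprn_ege1// ler1n. Qed.

Lemma weight0 : weight 0 = 1.
Proof.
rewrite /weight [height 0](_ : _ = 0%N)//.
by rewrite /height /dyadic_height /ramp sub0n big_ord1 /= logn0.
Qed.

Lemma weight_step n : weight n.+1 <= 2 * weight n.
Proof. by rewrite -exprS ler_eXn2l ?ltr1n// height_step. Qed.

Lemma le_weight h n : (h <= height n)%N -> 2 ^+ h <= weight n.
Proof. by move=> hn; rewrite ler_eXn2l ?ltr1n. Qed.

Definition periodic_layout : nat -> R[i] :=
  layout len (fun i k => letter (@task R i).2 (k %% 2 ^ (@task R i).1)).

Lemma periodic_layout_block i x : (start i <= x)%N -> (x < stop i)%N ->
  periodic_layout x = letter (@task R i).2 ((x - start i) %% 2 ^ (@task R i).1).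
Proof. exact: layoutE. Qed.

(** Where the layout is nonzero, at a position of block j >= i, it is at most j
    while the weight is at least 2 ^ j; then j (j + 1) <= 2 ^ j.+1. *)
Lemma periodic_layout_tail i x y : (y <= prev_stop i)%N -> (prev_stop i <= y + x)%N ->
  normc (periodic_layout (y + x)) * i.+1%:R <= 2 * weight x.
Proof.
move=> yi iyx; rewrite /periodic_layout /layout; set j := block stop (y + x).
have [jyx|] := leqP (start j) (y + x); last first.
  by rewrite normc0 mul0r mulr_ge0// ltW// weight_gt0.
have yxj : (y + x < stop j)%N.
  exact: block_lt (start_lt_stop len_gt0) (stop_le_start len) _.
have ij : (i <= j)%N.
  case: i yi iyx => // i _ /leq_trans iyx; rewrite ltnNge; apply/negP => ji.
  have := leq_trans yxj (block_end_mono (start_lt_stop len_gt0) (stop_le_start len) ji).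
  by rewrite ltnNge => /negP; apply; exact: iyx.
have jx : (j <= height x)%N.
  apply: (@height_block _ len_gt0 j x y) => //; apply: (leq_trans yi).
  exact: prev_stop_mono.
apply: (@le_trans _ _ (j%:R * j.+1%:R)).
  by rewrite ler_pM ?normc_ge0 ?letter_fits ?task_fits ?ler_nat.
apply: (@le_trans _ _ (2 * 2 ^+ j)); last by rewrite ler_wpM2l// le_weight.
rewrite -exprS -natrX -natrM ler_nat.
elim: (j) => // -[|[|[|n]]] //; rewrite (expnS 2 n.+4); nia.
Qed.

Definition c0_seed_seq n : R[i] := ((weight n)^-1)%:C * periodic_layout n.

Lemma c0_seed_pred : c0_pred c0_seed_seq.
Proof.
apply/c0_predP => e e0; pose i := Num.truncn (2 / e).
exists (prev_stop i) => n ni.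
rewrite normc_scale ?invr_gt0 ?weight_gt0// ler_pdivrMl ?weight_gt0//.
have := @periodic_layout_tail i n 0 isT ni; rewrite add0n -ler_pdivlMr// => /le_trans; apply.
rewrite mulrAC mulrC (ler_wpM2l (ltW (weight_gt0 _)))//.
by rewrite ler_pdivrMr// -ler_pdivrMl// mulrC ltW// truncnS_gt.
Qed.

Definition c0_seed : c0 R := C0 c0_seed_pred.

Section shift.
Context (B : {linear c0 R -> c0 R}).
Context (BE : forall (x : c0 R) n, B x n = (weight n.+1 / weight n)%:C * x n.+1).

Lemma iter_B k (x : c0 R) n :
  iter k B x n = (weight (n + k)%N / weight n)%:C * x (n + k)%N.
Proof. exact: (iter_shift weight_gt0 BE). Qed.

Lemma iter_c0_seed k n : iter k B c0_seed n = ((weight n)^-1)%:C * periodic_layout (k + n).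
Proof.
rewrite iter_B /= /c0_seed_seq mulrA -rmorphM/= addnC; congr (_%:C * _).
by rewrite mulrAC divff ?mul1r// gt_eqF// weight_gt0.
Qed.

(** Three kinds of coordinates: the first 2 ^ r show the word; the rest of the
    block shows further copies, at distance less than [size s] from multiples of
    2 ^ r; later blocks are covered by [periodic_layout_tail]. *)
Lemma c0_seed_return i s r c (e : R) : @task R i = (r, s) -> (size s <= 2 ^ r)%N ->
  (forall k, normc (letter s k) * 2 ^+ size s <= e * 2 ^+ r) -> 2 <= e * i.+2%:R ->
  (c * 2 ^ r + 2 ^ r <= len i (start i))%N ->
  rnorm (iter (start i + c * 2 ^ r)%N B c0_seed - word_c0 weight s) <= e.
Proof.
move=> irs sr se ie ci; set n := (start i + c * 2 ^ r)%N.
have e0 : 0 <= e by rewrite -(pmulr_lge0 _ (ltr0Sn R i.+1)) (le_trans _ ie).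
apply: rnorm_c0_le => k.
have -> : (iter n B c0_seed - word_c0 weight s) k =
    ((weight k)^-1)%:C * (periodic_layout (n + k) - letter s k).
  by rewrite mulrBr -iter_c0_seed.
rewrite normc_scale ?invr_gt0 ?weight_gt0// ler_pdivrMl ?weight_gt0//.
have nk : (start i <= n + k)%N by rewrite /n -addnA leq_addr.
have nki : (n + k - start i = c * 2 ^ r + k)%N by rewrite /n -addnA addKn.
have [kr|rk] := ltnP k (2 ^ r).
  rewrite (@periodic_layout_block i)//; last by rewrite /stop /n; lia.
  rewrite irs /= nki modnMDl modn_small// subrr normc0.
  by rewrite mulr_ge0// ltW// weight_gt0.
rewrite [letter s k]letter_default ?(leq_trans sr)// subr0.
have [nks|snk] := ltnP (n + k) (stop i); last first.
  have ni : (n <= prev_stop i.+1)%N by rewrite prev_stopS /stop /n; lia.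
  have := periodic_layout_tail ni snk; rewrite -ler_pdivlMr// => /le_trans; apply.
  by rewrite mulrAC mulrC (ler_wpM2l (ltW (weight_gt0 _)))// ler_pdivrMr.
rewrite (@periodic_layout_block i)// irs /= nki modnMDl.
set k' := (k %% 2 ^ r)%N.
have [k's|sk'] := ltnP k' (size s); last first.
  by rewrite letter_default// normc0 mulr_ge0// ltW// weight_gt0.
have kE : k = ((k %/ 2 ^ r) * 2 ^ r + k')%N by rewrite -divn_eq.
have hk : (r - k' <= height k)%N.
  by rewrite kE height_dyadic// divn_gt0 ?expn_gt0.
have h1 : normc (letter s k') <= e * 2 ^+ r / 2 ^+ size s.
  by rewrite ler_pdivlMr ?exprn_gt0.
apply: (le_trans h1); rewrite mulrC ler_pdivrMl ?exprn_gt0// (mulrC (weight k)) mulrCA ler_wpM2l//.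
apply: (@le_trans _ _ (2 ^+ size s * 2 ^+ (r - k'))); last first.
  by rewrite ler_wpM2l ?exprn_ge0// le_weight.
by rewrite -exprD ler_eXn2l ?ltr1n//; lia.
Qed.

Lemma sum_id_c0_seed_return (U : set (l1sum (c0 R) R[i]^o)) : open U -> U !=set0 ->
  exists r, forall N, exists2 i, (N <= i)%N &
    forall c, (c * 2 ^ r + 2 ^ r <= len i (start i))%N ->
      return_times (sum_id B) (c0_seed, 1 : R[i]^o) U (start i + c * 2 ^ r)%N.
Proof.
move=> oU U0.
have [s [e [e0 eU]]] := return_times_target B c0_seed (word_c0_dense weight_ge1) oU U0.
have [M sM] := @fits_eventually R s.
(* 2 ^ r > r dominates both the length of the word and the bound on its entries. *)
pose r := (size s + Num.truncn (M%:R * 2 ^+ size s / (e / 2))).+1.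
have e2 : 0 < e / 2 by rewrite divr_gt0.
exists r => N.
have [i Ni irs] := @task_recurrent R r s (N + Num.truncn (2 / (e / 2))).
exists i; first by lia.
move=> c ci; apply: eU; apply: (@le_lt_trans _ _ (e / 2)); last by lra.
apply: (c0_seed_return irs) => //.
- by rewrite (leq_trans _ (ltnW (ltn_expl r (isT : (1 < 2)%N))))// /r; lia.
- move=> k; apply: (@le_trans _ _ (M%:R * 2 ^+ size s)).
    by rewrite ler_wpM2r ?exprn_ge0// letter_fits// sM.
  rewrite [leRHS]mulrC -ler_pdivrMr// ltW//; apply: (lt_le_trans (truncnS_gt _)).
  rewrite -[leRHS](natrX R 2 r) ler_nat; apply: (leq_trans _ (ltnW (ltn_expl r (isT : (1 < 2)%N)))).
  by rewrite /r ltnS leq_addl.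
- rewrite [leRHS]mulrC -ler_pdivrMr// ltW//; apply: (lt_le_trans (truncnS_gt _)).
  by rewrite ler_nat ltnS (leq_trans _ (leqW Ni))// leq_addl.
Qed.

(** At a return time n, |c| < W(n) |x(n)| with x(n) tending to 0. *)
Lemma return_times_high : exists U : set (l1sum (c0 R) R[i]^o), [/\ open U, U !=set0 &
  forall z, (exists n, return_times (sum_id B) z U n) -> forall r, exists N,
    forall n, (N <= n)%N -> return_times (sum_id B) z U n -> (r <= height n)%N].
Proof.
have y1 : 1 < normc (word_c0 weight [:: (2, 0)] 0%N).
  have -> : word_c0 weight [:: (2, 0)] 0%N = ((weight 0)^-1)%:C * (ratr 2 +i* ratr 0) by [].
  by rewrite weight0 invr1 mul1r rmorph0 ratr_nat normc_real ger0_norm ?ltr1n.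
have [K [U [oU U0 retU]]] := sum_id_return_coordinate B
  (fun (x y : c0 R) n => erefl _) (fun a (x : c0 R) n => erefl _)
  normc_le_rnorm_c0 y1.
exists U; split => // -[x c] [m /retU/= [_ mK]] r.
have c0 : 0 < normc c.
  rewrite lt_neqAle normc_ge0 andbT; apply/eqP => c0; move: mK.
  by rewrite -c0 mulr0 ltNge rnorm_ge0.
have /c0_predP/(_ _ (divr_gt0 c0 (exprn_gt0 r (ltr0n _ 2))))[N xN] : c0_pred x by case: x {mK}.
exists N => n Nn /retU/= [+ _]; rewrite iter_B weight0 divr1 add0n.
rewrite normc_scale ?weight_gt0// => cn.
rewrite leqNgt; apply/negP => hr.
have : weight n * normc (x n) <= 2 ^+ r * (normc c / 2 ^+ r).
  apply: ler_pM; [exact: ltW (weight_gt0 _)|exact: normc_ge0| |exact: xN].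
  by rewrite ler_eXn2l ?ltr1n// ltnW.
by rewrite mulrCA divff ?mulr1 ?expf_neq0// leNgt cn.
Qed.

End shift.
End c0_operator.

Section c0_density.
Context {R : realType}.

(** The height exceeds a large r only on a set that is dyadically sparse, or where
    the ramp is positive; each part has at most a quarter of the proportion d. *)
Lemma count_in_sparse (len : nat -> nat -> nat) (E : set nat) (d : R) :
  (forall i m, (0 < len i m)%N) -> 0 < d ->
  (forall r, exists N, forall n, (N <= n)%N -> E n -> (r <= height len n)%N) ->
  exists i0, forall i m, (i0 <= i)%N -> (lead len i <= m)%N ->
    (i.+1 * count_in [set x | (0 < ramp (stop len) (lead len) x)%N] 0 m <= 4 * m)%N ->
    (count_in E 0 m)%:R < d * (m%:R - 1).
Proof.
move=> len_gt0 d0 Eh; pose r := (Num.truncn (32 / d)).+1.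
have [N EN] := Eh r.
exists (N + Num.truncn (16 / d) + Num.truncn (4 * (N%:R + d) / d))%N => i m i0 im.
set C := count_in [set x | (0 < ramp _ _ x)%N] 0 m => Cm.
have := @dyadic_height_count r m isT.
set D := count_in _ 0 m => Dm.
have ND : (count_in E 0 m <= N + (D + C))%N.
  apply: (@leq_trans (count_in [set x | (x < N)%N] 0 m + count_in [set x | (r <= height len x)%N] 0 m)).
    apply: leq_trans (count_inU _ _ _ _); apply: count_in_sub => x _ Ex /=.
    by have [xN|Nx] := ltnP x N; [left|right; exact: EN].
  rewrite leq_add//; last exact: count_height.
  have [Nm|mN] := leqP N m; last first.
    by rewrite (leq_trans (count_in_le _ _ _))// subn0 ltnW.
  rewrite (@count_in_cat _ _ N)// [X in (_ + X)%N]count_in_set0 ?addn0; last first.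
    by move=> x /andP[Nx _] /=; rewrite ltnNge Nx.
  by rewrite (leq_trans (count_in_le _ _ _))// subn0.
have Ni : (i < m)%N.
  by apply: leq_trans im; rewrite /lead leq_pmulr// (leq_ltn_trans (leq0n _) (prev_stop_gt len_gt0 i)).
have trunc_le (x : R) (k : nat) : (Num.truncn (x / d) < k)%N -> x < d * k%:R.
  by move=> xk; rewrite mulrC -ltr_pdivrMr// (lt_le_trans (truncnS_gt _))// ler_nat.
have hN : 4 * (N%:R + d) < d * m%:R.
  by apply: trunc_le; apply: leq_ltn_trans Ni; apply: leq_trans i0; rewrite leq_addl.
have hi : 16 < d * i.+1%:R.
  by apply: trunc_le; rewrite ltnS; apply: leq_trans i0; rewrite -addnA addnCA leq_addr.
have hr : 32 < d * (2 ^ r)%:R.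
  by apply: trunc_le; exact: ltn_trans (ltnSn _) (ltn_expl r (isT : (1 < 2)%N)).
have DR : (2 ^ r)%:R * D%:R <= 8 * m%:R :> R by rewrite -!natrM ler_nat.
have CR : i.+1%:R * C%:R <= 4 * m%:R :> R by rewrite -!natrM ler_nat.
have NR : (count_in E 0 m)%:R <= N%:R + (D%:R + C%:R) :> R.
  by rewrite -!natrD ler_nat.
have D0 : 0 <= D%:R :> R by [].
have C0 : 0 <= C%:R :> R by [].
have D4 : 32 * D%:R <= d * (8 * m%:R).
  by rewrite (le_trans (ler_wpM2r D0 (ltW hr)))// -mulrA ler_wpM2l// ltW.
have C4 : 16 * C%:R <= d * (4 * m%:R).
  by rewrite (le_trans (ler_wpM2r C0 (ltW hi)))// -mulrA ler_wpM2l// ltW.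
by move: D4 C4; rewrite !(mulrCA d) => D4 C4; lra.
Qed.

(** Block i extends from its start a to 2 a, so it fills half of [0, 2 a]; the
    failure of positive lower density is seen at the feet lead i. *)
Lemma c0_U_frequently_not_frequently :
  exists T : {linear l1sum (c0 R) R[i]^o -> l1sum (c0 R) R[i]^o},
    [/\ bounded_operator T, U_frequently_supercyclic T & ~ frequently_supercyclic T].
Proof.
pose len (_ m : nat) := m.+1.
have len_gt0 i m : (0 < len i m)%N by [].
have [B BE BM] := c0_shift (@weight_gt0 R len) (@weight_step R _ len_gt0).
exists (sum_id B); split.
- by apply: bounded_sum_id BM; rewrite ler1n.
- exists (c0_seed len_gt0, 1) => U oU U0.
  have [r retU] := sum_id_c0_seed_return len_gt0 BE oU U0.
  apply: (@upper_density_gt0W _ _ (2 ^+ r.+2)^-1); first by rewrite invr_gt0 exprn_gt0.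
  move=> N; have [i Ni {}retU] := retU (N + 2 ^ r.+1)%N.
  set a := start len i in retU.
  have ia : (i <= a)%N by rewrite /a /start leq_addl.
  exists (2 * a)%N; first by lia.
  rewrite ler_pdivrMl ?exprn_gt0// -natrX -natrM ler_nat.
  set E := return_times _ _ U in retU *.
  (* At least (a.+1 - 2 ^ r) / 2 ^ r return times lie below 2 a, and a >= 2 ^ r.+1. *)
  have : (a.+1 - 2 ^ r <= 2 ^ r * count_in E a (a + (a.+1 - 2 ^ r)))%N.
    apply: count_in_progression => [|c ca]; first by rewrite expn_gt0.
    by apply: retU; rewrite /len -/a; lia.
  have -> : (2 ^ r.+2 = 4 * 2 ^ r)%N by rewrite !expnS mulnA.
  rewrite (@count_in_cat _ 0 a); [|lia|lia].
  rewrite (@count_in_cat _ a (a + (a.+1 - 2 ^ r)) (2 * a).+1); [|lia|lia].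
  by rewrite expnS in Ni; nia.
- move=> [z zU]; have [U [oU U0 retU]] := return_times_high BE.
  have [d d0 [N dN]] := lower_density_gt0 (zU U oU U0).
  have [n nU] : exists n, return_times (sum_id B) z U n.
    apply: contrapT => noU; have := dN N.+1 (leqnSn N).
    rewrite count_in_set0 => [|n _ nU]; last by apply: noU; exists n.
    by rewrite leNgt mulr_gt0.
  have [i0 sparse] := count_in_sparse len_gt0 d0 (retU z (ex_intro _ n nU)).
  pose i := (i0 + N)%N.
  have Ni : (N < lead len i)%N.
    apply: (@leq_trans i.+1); first by rewrite ltnS leq_addl.
    by rewrite leq_pmulr// (leq_ltn_trans (leq0n _) (prev_stop_gt len_gt0 i)).
  have := sparse i (lead len i) (leq_addr _ _) (leqnn _).
  have Cl : (i.+1 * count_in [set x | (0 < ramp (stop len) (lead len) x)%N] 0 (lead len i)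
      <= 4 * lead len i)%N.
    by rewrite (leq_trans (leq_mul (leqnn _) (count_ramp_lead _ i)))// leq_pmull.
  move=> /(_ Cl); have := dN (lead len i).-1.
  rewrite prednK; last exact: leq_ltn_trans Ni.
  have -> : (lead len i).-1%:R = (lead len i)%:R - 1 :> R.
    by rewrite -subn1 natrB//; exact: leq_ltn_trans Ni.
  by rewrite ltNge => -> //; lia.
Qed.

(** Block i has length i + 1: long enough for windows of every length, too short to
    be seen by the upper density. *)
Lemma c0_reiteratively_not_U_frequently :
  exists T : {linear l1sum (c0 R) R[i]^o -> l1sum (c0 R) R[i]^o},
    [/\ bounded_operator T, reiteratively_supercyclic T & ~ U_frequently_supercyclic T].
Proof.
pose len (i _ : nat) := i.+1.
have len_gt0 i m : (0 < len i m)%N by [].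
have [B BE BM] := c0_shift (@weight_gt0 R len) (@weight_step R _ len_gt0).
exists (sum_id B); split.
- by apply: bounded_sum_id BM; rewrite ler1n.
- exists (c0_seed len_gt0, 1) => U oU U0.
  have [r retU] := sum_id_c0_seed_return len_gt0 BE oU U0.
  apply: (@upper_banach_density_gt0W _ _ (2 ^+ r)^-1); first by rewrite invr_gt0 exprn_gt0.
  move=> s N; have [i Ni {}retU] := retU (N + s + 2 ^ r).+1.
  set a := start len i in retU.
  have ia : (i <= a)%N by rewrite /a /start leq_addl.
  exists a.-1; first by lia.
  rewrite ler_pdivrMl ?exprn_gt0// -natrX -natrM ler_nat /window_count.
  rewrite prednK; last by lia.
  have -> : ((a.-1 + s.+1).+1 = a + s.+1)%N by lia.
  apply: count_in_progression => [|c ca]; first by rewrite expn_gt0.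
  by apply: retU; rewrite /len; lia.
- move=> [z zU]; have [U [oU U0 retU]] := return_times_high BE.
  have [d d0 dN] := upper_density_gt0 (zU U oU U0).
  have [n nU] : exists n, return_times (sum_id B) z U n.
    apply: contrapT => noU; have [n n1] := dN 1%N.
    rewrite count_in_set0 => [|m _ mU]; last by apply: noU; exists m.
    by rewrite leNgt mulr_gt0// ltr0n.
  have [i0 sparse] := count_in_sparse len_gt0 d0 (retU z (ex_intro _ n nU)).
  have [m mi] := dN (lead len i0).
  have [i [ii0 im mi1]] : exists i, [/\ (i0 <= i)%N, (lead len i <= m.+1)%N & (m.+1 <= lead len i.+1)%N].
    have lead_m : exists i, (m.+1 <= lead len i.+1)%N.
      exists m; rewrite /lead mulSn (leq_trans _ (leq_addl _ _))//.
      by rewrite leq_pmulr// (leq_ltn_trans (leq0n _) (prev_stop_gt len_gt0 _)).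
    case: (ex_minnP lead_m) => i mi1 imin.
    have [i0i|ii0] := leqP i0 i.
      exists i; split => //; case: i mi1 imin i0i => [|i] mi1 imin i0i.
        by move: i0i mi; rewrite leqn0 => /eqP ->; exact: leqW.
      by rewrite leqNgt; apply/negP => /ltnW /imin; rewrite ltnn.
    exists i0; split => //; first exact: leqW.
    apply: (leq_trans mi1); rewrite /lead leq_mul//; first by lia.
    by apply: prev_stop_mono => //; rewrite ltnS ltnW.
  have := sparse i m.+1 ii0 im (count_ramp_short len_gt0 (fun _ _ => erefl) im mi1).
  by rewrite -natr1 addrK ltNge => /negP.
Qed.

End c0_density.

(** * Weighted shifts on l_p *)

Section lp_facts.
Context {R : realType} {p : R} (p1 : 1 <= p).
Implicit Types (x y : lp p1) (W : nat -> R).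

Let p_gt0 : 0 < p. Proof. exact: lt_le_trans ltr01 p1. Qed.
Let pV_gt0 : 0 < p^-1. Proof. by rewrite invr_gt0. Qed.

Lemma powR_le (a b : R) (q : R) : 0 <= q -> 0 <= a -> a <= b -> a `^ q <= b `^ q.
Proof. by move=> q0 a0 ab; rewrite ge0_ler_powR// nnegrE ?(le_trans a0). Qed.

Lemma powRK (a : R) : 0 <= a -> (a `^ p) `^ p^-1 = a.
Proof. by move=> a0; rewrite -powRrM divff ?gt_eqF// powRr1. Qed.

Lemma powRVK (a : R) : 0 <= a -> (a `^ p^-1) `^ p = a.
Proof. by move=> a0; rewrite -powRrM mulVf ?gt_eqF// powRr1. Qed.

Definition power_sum (x : nat -> R[i]) m n : R := \sum_(m <= k < n) normc (x k) `^ p.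

Lemma power_sum_ge0 (x : nat -> R[i]) m n : 0 <= power_sum x m n.
Proof. by apply: sumr_ge0 => k _; exact: powR_ge0. Qed.

Lemma power_sum_enorm (x : nat -> R[i]) (C : R) :
  (forall N, power_sum x 0 N <= C) ->
  ((\sum_(n <oo) ((normc (x n)) `^ p)%:E) <= C%:E)%E.
Proof.
move=> xC; apply: lime_le.
  by apply: is_cvg_nneseries => n _ _; rewrite lee_fin powR_ge0.
by apply: nearW => N; rewrite sumEFin lee_fin; exact: xC.
Qed.

Lemma power_sum_pred (x : nat -> R[i]) (C : R) :
  (forall N, power_sum x 0 N <= C) -> lp_pred p1 x.
Proof. by move=> /power_sum_enorm xC; exact: le_lt_trans xC (ltry _). Qed.

Lemma rnorm_lp x : exists s : R, [/\ 0 <= s, rnorm x = s `^ p^-1 &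
  (\sum_(n <oo) ((normc (x n)) `^ p)%:E)%E = s%:E].
Proof.
have : (\sum_(n <oo) ((normc (x n)) `^ p)%:E < +oo)%E by case: x.
have := lp_sum_ge0 (p := p) x.
rewrite /rnorm [`|x|]/(lp_norm x) /lp_norm /lp_enorm /=.
by case: (\sum_(_ <oo) _)%E => // s s0 _; exists s.
Qed.

Lemma rnorm_lp_le x (C : R) : 0 <= C -> (forall N, power_sum x 0 N <= C `^ p) ->
  rnorm x <= C.
Proof.
move=> C0 /power_sum_enorm; have [s [s0 -> ->]] := rnorm_lp x.
by rewrite lee_fin -{2}(powRK C0) => /powR_le; apply=> //; exact: ltW.
Qed.

Lemma power_sum_cat (x : nat -> R[i]) m n k : (m <= n)%N -> (n <= k)%N ->
  power_sum x m k = power_sum x m n + power_sum x n k.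
Proof. exact: big_cat_nat. Qed.

Lemma power_sum_le_rnorm x N : power_sum x 0 N <= rnorm x `^ p.
Proof.
have [s [s0 -> sE]] := rnorm_lp x; rewrite powRVK// -lee_fin -sE -sumEFin.
by apply: nneseries_lim_ge => n _ _; rewrite lee_fin powR_ge0.
Qed.

Lemma normc_le_rnorm_lp x n : normc (x n) <= rnorm x.
Proof.
rewrite -(powRK (normc_ge0 (x n))) -(powRK (rnorm_ge0 x)).
apply: powR_le; [exact: ltW|exact: powR_ge0|].
apply: le_trans (power_sum_le_rnorm x n.+1).
by rewrite /power_sum big_nat_recr//= lerDr sumr_ge0// => k _; exact: powR_ge0.
Qed.

Lemma power_sum_tail x (e : R) : 0 < e -> exists K, forall N, power_sum x K N <= e.
Proof.
move=> e0; pose P := range (power_sum x 0).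
have Psup : has_sup P.
  split; first by exists (power_sum x 0 0), 0%N.
  by exists (rnorm x `^ p) => _ [N _ <-]; exact: power_sum_le_rnorm.
have [_ [K _ <-] Ke] := sup_adherent e0 Psup.
exists K => N; have [KN|NK] := leqP K N; last first.
  by rewrite /power_sum big_geq ?ltW// ltnW.
have : power_sum x 0 N <= sup P by apply: ub_le_sup; [exact: Psup.2|exists N].
by rewrite (power_sum_cat x (leq0n K) KN); lra.
Qed.

Lemma lp_shift W (M : R) : (forall n, 0 < W n) -> (forall n, W n.+1 <= M * W n) ->
  exists2 B : {linear lp p1 -> lp p1},
    (forall x n, B x n = (W n.+1 / W n)%:C * x n.+1) &
    (forall x, `|B x| <= M%:C * `|x|).
Proof.
move=> W0 WM.
have M0 : 0 < M by rewrite -(pmulr_lgt0 _ (W0 0%N)) (lt_le_trans (W0 1%N)).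
have le1 x n : normc ((W n.+1 / W n)%:C * x n.+1) <= M * normc (x n.+1).
  rewrite normc_scale ?divr_gt0// ler_wpM2r ?normc_ge0//.
  by rewrite ler_pdivrMr.
have sumB x N : power_sum (fun n => (W n.+1 / W n)%:C * x n.+1) 0 N <=
    (M * rnorm x) `^ p.
  rewrite powRM ?rnorm_ge0 ?(ltW M0)//.
  apply: (@le_trans _ _ (M `^ p * power_sum x 0 N.+1)); last first.
    by rewrite ler_wpM2l ?powR_ge0// power_sum_le_rnorm.
  apply: (@le_trans _ _ (M `^ p * power_sum x 1 N.+1)); last first.
    rewrite ler_wpM2l ?powR_ge0// (power_sum_cat x (leq0n 1) (ltn0Sn N)).
    by rewrite lerDr power_sum_ge0.
  rewrite /power_sum big_distrr big_add1 /=; apply: ler_sum => n _.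
  rewrite -powRM ?normc_ge0 ?(ltW M0)//; apply: powR_le (le1 x n); rewrite ?normc_ge0//.
  exact: ltW.
have Bp x : lp_pred p1 (fun n => (W n.+1 / W n)%:C * x n.+1).
  exact: power_sum_pred (sumB x).
pose f x : lp p1 := Lp (Bp x).
have f_linear : linear f.
  move=> a x y; apply/val_inj/funext => n.
  by rewrite /= [LHS]mulrDr; congr (_ + _); rewrite /= mulrCA.
pose fL := GRing.isLinear.Build R[i] (lp p1) (lp p1) _ f f_linear.
pose B : {linear lp p1 -> lp p1} := HB.pack f fL.
exists B => // x; rewrite !rnormE -rmorphM/= lecR.
by apply: rnorm_lp_le; [rewrite mulr_ge0 ?rnorm_ge0// ltW|exact: sumB].
Qed.

Lemma word_lp_pred W s : lp_pred p1 (word W s).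
Proof.
apply: (@power_sum_pred _ (power_sum (word W s) 0 (size s))) => N.
have [Ns|sN] := leqP N (size s).
  by rewrite (power_sum_cat _ (leq0n N) Ns) lerDl power_sum_ge0.
rewrite (power_sum_cat _ (leq0n (size s)) (ltnW sN)) gerDl.
rewrite /power_sum big_nat big1// => k /andP[sk _].
by rewrite word_default// normc0 powR0// gt_eqF.
Qed.

Definition word_lp W s : lp p1 := Lp (word_lp_pred W s).

Lemma word_lp_dense W : (forall n, 1 <= W n) ->
  forall y (e : R), 0 < e -> exists s, rnorm (y - word_lp W s) < e.
Proof.
move=> W1 y e e0; pose E := (e / 2) `^ p.
have e2 : 0 < e / 2 by rewrite divr_gt0.
have E2 : 0 < E / 2 by rewrite divr_gt0// powR_gt0.
have [K yK] := power_sum_tail y E2.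
pose a := E / 2 / K.+1%:R.
have a0 : 0 < a by rewrite divr_gt0.
have [s [sK ys]] := word_approx y K W1 (powR_gt0 p^-1 a0).
exists s; apply: (@le_lt_trans _ _ (e / 2)); last by lra.
apply: rnorm_lp_le => [|N]; first exact: ltW.
have xE n : (y - word_lp W s) n = y n - word W s n by [].
have {}ys n : (n < K)%N -> normc ((y - word_lp W s) n) `^ p <= a.
  move=> /ys; rewrite xE -{2}(powRVK (ltW a0)) => /powR_le; apply; rewrite ?normc_ge0//.
  exact: ltW.
have ya : power_sum (y - word_lp W s) 0 K <= E / 2.
  apply: (@le_trans _ _ (\sum_(0 <= n < K) a)).
    by rewrite /power_sum !big_nat; apply: ler_sum => n /ys.
  rewrite sumr_const_nat subn0 -[a *+ K]mulr_natr /a mulrAC ler_pdivrMr//.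
  by rewrite ler_wpM2l ?ler_nat// ltW.
rewrite -/E; have [NK|KN] := leqP N K.
  have := power_sum_ge0 (y - word_lp W s) N K.
  by have := power_sum_cat (y - word_lp W s) (leq0n N) NK; lra.
rewrite (power_sum_cat _ (leq0n K) (ltnW KN)).
have -> : power_sum (y - word_lp W s) K N = power_sum y K N.
  rewrite /power_sum !big_nat; apply: eq_bigr => n /andP[Kn _].
  by rewrite xE word_default ?sK// subr0.
by have := yK N; lra.
Qed.

End lp_facts.

(** * The operators on l_p *)

Section lp_operator.
Context {R : realType} {p : R} (p1 : 1 <= p).

Let p_gt0 : 0 < p. Proof. exact: lt_le_trans ltr01 p1. Qed.
Let pV_gt0 : 0 < p^-1. Proof. by rewrite invr_gt0. Qed.

Definition sqrtS n : R := Num.sqrt n.+1%:R.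

Lemma sqrtS_ge1 n : 1 <= sqrtS n.
Proof. by rewrite -sqrtr1 ler_wsqrtr// ler1n. Qed.

Lemma sqrtS_gt0 n : 0 < sqrtS n.
Proof. exact: lt_le_trans ltr01 (sqrtS_ge1 n). Qed.

Lemma sqrtS_le m n : (m <= n)%N -> sqrtS m <= sqrtS n.
Proof. by move=> mn; rewrite ler_wsqrtr// ler_nat. Qed.

Lemma sqrtS_square t : (0 < t)%N -> sqrtS (t ^ 2).-1 = t%:R.
Proof.
by move=> t0; rewrite /sqrtS prednK ?expn_gt0 ?t0// natrX sqrtr_sqr ger0_norm.
Qed.

Definition root_weight n : R := sqrtS n `^ p^-1.

Lemma root_weightK n : root_weight n `^ p = sqrtS n.
Proof. by rewrite powRVK// ltW// sqrtS_gt0. Qed.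

Lemma root_weight_gt0 n : 0 < root_weight n.
Proof. exact/powR_gt0/sqrtS_gt0. Qed.

Lemma root_weight_ge1 n : 1 <= root_weight n.
Proof.
have <- : 1 `^ p^-1 = 1 :> R by rewrite powR1.
by apply: powR_le (sqrtS_ge1 n) => //; exact: ltW.
Qed.

Lemma root_weight0 : root_weight 0 = 1.
Proof. by rewrite /root_weight /sqrtS sqrtr1 powR1. Qed.

Lemma root_weight_step n : root_weight n.+1 <= 2 * root_weight n.
Proof.
apply: (@le_trans _ _ ((2 * sqrtS n) `^ p^-1)).
  apply: powR_le; [exact: ltW|exact: ltW (sqrtS_gt0 _)|].
  rewrite -{1}(@ger0_norm R 2)// -sqrtr_sqr -sqrtrM ?sqr_ge0// ler_wsqrtr//.
  by rewrite -natrX -natrM ler_nat; lia.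
rewrite powRM ?(ltW (sqrtS_gt0 _))// ler_wpM2r ?(ltW (root_weight_gt0 _))//.
rewrite -[leRHS](@powRr1 R 2)// ler_powR ?ler1n// invf_le1//.
Qed.

(** A bound, inflated by 2 ^ i, for the sum of the p-th powers of the at most i
    entries of word i, each of modulus at most i. *)
Definition load i : R := 2 ^+ i * i%:R * i%:R `^ p.

(** The length given to block i, almost all of it empty: it separates the words of
    blocks i and i.+1 enough for the weight to outgrow [load i.+1]. A square, so
    that the square root in the weight is exact. *)
Definition spacing i (_ : nat) := ((i + Num.truncn (load i.+1)).+1 ^ 2)%N.

Lemma spacing_gt0 i m : (0 < spacing i m)%N.
Proof. by rewrite expn_gt0. Qed.

Lemma le_spacing i m : (i <= spacing i m)%N.
Proof.
by rewrite /spacing expnS expn1 (leq_trans _ (leq_pmulr _ _))// leqW// leq_addr.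
Qed.

Local Notation start := (start spacing).
Local Notation stop := (stop spacing).
Local Notation prev_stop := (prev_stop spacing).
Definition gap i := (start i - prev_stop i)%N.

Lemma load_gap i : load i <= sqrtS (gap i).
Proof.
case: i => [|i].
  by rewrite /load mulr0 mul0r ltW// sqrtS_gt0.
set t := (i + Num.truncn (load i.+1)).+1.
have : load i.+1 <= t%:R.
  by rewrite ltW// (lt_le_trans (truncnS_gt _))// ler_nat ltnS leq_addl.
move=> /le_trans; apply; rewrite -(@sqrtS_square t)// sqrtS_le//.
have : (spacing i (start i) <= gap i.+1)%N.
  rewrite /gap /start prev_stopS /stop /lead prev_stopS /stop.
  by set sp := spacing _ _; nia.
by rewrite /spacing -/t; lia.
Qed.

Definition single_layout : nat -> R[i] := layout spacing (fun i k => letter (@task R i).2 k).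

(** A summable bound for the p-th power of the coordinate at position x, valid for
    every time n before the block of x: the weight at distance x - n is at least
    the weight at distance [gap]. *)
Definition majorant x : R :=
  normc (single_layout x) `^ p / sqrtS (gap (block stop x)).

Lemma majorant_ge0 x : 0 <= majorant x.
Proof. by rewrite divr_ge0 ?powR_ge0// ltW// sqrtS_gt0. Qed.

Lemma majorant_eq0 x : single_layout x = 0 -> majorant x = 0.
Proof. by move=> x0; rewrite /majorant x0 normc0 powR0 ?mul0r// gt_eqF. Qed.

Lemma single_layout_majorant i x n : (n <= prev_stop i)%N -> (prev_stop i <= n + x)%N ->
  normc (single_layout (n + x)) `^ p / sqrtS x <= majorant (n + x).
Proof.
move=> ni inx; rewrite /majorant /single_layout /layout; set j := block stop (n + x).
have [jnx|] := leqP (start j) (n + x); last by rewrite normc0 powR0 ?mul0r// gt_eqF.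
rewrite ler_wpM2l ?powR_ge0// lef_pV2 ?posrE ?sqrtS_gt0// sqrtS_le//.
have ij : (i <= j)%N.
  case: i ni inx => // i _ /leq_trans inx; rewrite ltnNge; apply/negP => ji.
  have nxj : (n + x < stop j)%N.
    exact: block_lt (start_lt_stop spacing_gt0) (stop_le_start spacing) _.
  have := leq_trans nxj (block_end_mono (start_lt_stop spacing_gt0) (stop_le_start spacing) ji).
  by rewrite ltnNge => /negP; apply; exact: inx.
have := leq_trans ni (prev_stop_mono spacing_gt0 ij).
by rewrite /gap; lia.
Qed.

(** At most j positions of block j carry a nonzero entry. *)
Lemma majorant_block j :
  \sum_(prev_stop j <= x < prev_stop j.+1) majorant x <= 2 ^- j.
Proof.
have j1 : (prev_stop j <= start j)%N.
  exact: leq_trans (prev_stop_le_lead _ _) (lead_le_start _ _).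
have j2 : (start j + j <= stop j)%N by rewrite /stop leq_add2l le_spacing.
have size_j : (size (@task R j).2 <= j)%N by have /andP[] := @task_fits R j.
rewrite prev_stopS (@big_cat_nat _ _ _ (start j))//=; last by lia.
rewrite big_nat big1 ?add0r => [|x /andP[jx xj]]; last first.
  by apply/majorant_eq0/(layout_gap spacing_gt0 _ jx xj).
rewrite (@big_cat_nat _ _ _ (start j + j))//=; last by lia.
rewrite [X in _ + X]big_nat [X in _ + X]big1 ?addr0 => [|x /andP[jx xj]]; last first.
  apply: majorant_eq0; rewrite /single_layout (@layoutE _ _ spacing_gt0 _ j)//; last by lia.
  by rewrite letter_default//; lia.
apply: (@le_trans _ _ (\sum_(start j <= x < start j + j) (j%:R `^ p / sqrtS (gap j)))).
  rewrite !big_nat; apply: ler_sum => x /andP[jx xj].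
  have xs : (x < stop j)%N by lia.
  rewrite /majorant (blockE (start_lt_stop spacing_gt0) (stop_le_start spacing) jx xs).
  rewrite ler_wpM2r ?invr_ge0 ?(ltW (sqrtS_gt0 _))// /single_layout (layoutE spacing_gt0 _ jx xs).
  by apply: powR_le; [exact: ltW|exact: normc_ge0|exact/letter_fits/task_fits].
rewrite sumr_const_nat addKn -[X in X <= _]mulr_natr mulrAC ler_pdivrMr ?sqrtS_gt0//.
rewrite ler_pdivlMl ?exprn_gt0//; apply: le_trans (load_gap j).
by rewrite /load -mulrA (mulrC (_ `^ p)).
Qed.

Lemma majorant_sum i N : \sum_(prev_stop i <= x < N) majorant x <= 2 * 2 ^- i.
Proof.
have blocks k : \sum_(prev_stop i <= x < prev_stop (i + k)) majorant x <=
    2 * 2 ^- i - 2 * 2 ^- (i + k).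
  elim: k => [|k IH]; first by rewrite addn0 big_geq// subrr.
  rewrite addnS (@big_cat_nat _ _ _ (prev_stop (i + k)))//=; last first.
  - by rewrite prev_stop_mono//; exact: spacing_gt0.
  - by rewrite prev_stop_mono ?leq_addr//; exact: spacing_gt0.
  have := majorant_block (i + k).
  have -> : 2 ^- (i + k) = 2 * 2 ^- (i + k).+1 :> R.
    by rewrite exprS invfM mulrA divff ?mul1r.
  by move: IH; rewrite -[X in _ - 2 * X](_ : 2 * 2 ^- (i + k).+1 = _); [lra|rewrite exprS invfM mulrA divff ?mul1r].
have NiN : (N <= prev_stop (i + N))%N.
  by apply: leq_trans (ltnW (prev_stop_gt spacing_gt0 (i + N))); rewrite leq_addl.
have [Ni|iN] := leqP N (prev_stop i).
  by rewrite big_geq// mulr_ge0.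
apply: le_trans (le_trans (blocks N) _); last by rewrite gerBl mulr_ge0.
rewrite [leRHS](@big_cat_nat _ _ _ N)//=; last exact: ltnW.
by rewrite lerDl sumr_ge0// => x _; exact: majorant_ge0.
Qed.

(** Used with n = 0 for membership of the seed in l_p, and with n = start i for the
    distance between the orbit at time n and word i. *)
Lemma power_sum_single_layout i n (z : nat -> R[i]) : (n <= prev_stop i)%N ->
  (forall k, (n + k < prev_stop i)%N -> z k = 0) ->
  (forall k, (prev_stop i <= n + k)%N -> z k = ((root_weight k)^-1)%:C * single_layout (n + k)) ->
  forall N, power_sum (p := p) z 0 N <= 2 * 2 ^- i.
Proof.
move=> ni z0 zE N; have zk k : (prev_stop i <= n + k)%N -> normc (z k) `^ p <= majorant (n + k).
  move=> ink; apply: le_trans (single_layout_majorant ni ink).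
  rewrite zE// normc_scale ?invr_gt0 ?root_weight_gt0// mulrC.
  rewrite powRM ?normc_ge0 ?invr_ge0 ?(ltW (root_weight_gt0 _))//.
  rewrite -[(root_weight k)^-1]powR_inv1 ?(ltW (root_weight_gt0 _))//.
  by rewrite -powRrM (mulrC (-1)) powRrM root_weightK powR_inv1// ltW// sqrtS_gt0.
have -> : power_sum (p := p) z 0 N = \sum_(n <= x < N + n) normc (z (x - n)%N) `^ p.
  by rewrite -{1}(add0n n) big_addn addnK; apply: eq_bigr => k _; rewrite addnK.
have [Ni|iN] := leqP (N + n) (prev_stop i).
  rewrite big_nat big1 ?mulr_ge0// => x /andP[nx xN].
  by rewrite z0 ?normc0 ?powR0 ?gt_eqF//; lia.
rewrite (@big_cat_nat _ _ _ (prev_stop i))//=; last exact: ltnW.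
rewrite big_nat big1 ?add0r => [|x /andP[nx xi]]; last first.
  by rewrite z0 ?normc0 ?powR0 ?gt_eqF//; lia.
apply: le_trans (majorant_sum i (N + n)); rewrite !big_nat.
apply: ler_sum => x /andP[ix _].
have nx : (n + (x - n) = x)%N by lia.
by have := zk (x - n)%N; rewrite nx => /(_ ix).
Qed.

End lp_operator.

Section lp_density.
Context {R : realType} {p : R} (p1 : 1 <= p).

Let p_gt0 : 0 < p. Proof. exact: lt_le_trans ltr01 p1. Qed.

Local Notation W := (@root_weight R p).
Local Notation start := (start (spacing (p := p))).
Local Notation stop := (stop (spacing (p := p))).
Local Notation prev_stop := (prev_stop (spacing (p := p))).
Local Notation single_layout := (@single_layout R p).

Lemma lp_seed_pred : lp_pred p1 (fun n => ((W n)^-1)%:C * single_layout n).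
Proof.
apply: (@power_sum_pred _ _ p1 _ (2 * 2 ^- 0)) => N.
apply: (power_sum_single_layout p1 (i := 0%N) (n := 0%N)) => // k; rewrite add0n.
rewrite ltnS leqn0 => /eqP ->; rewrite /single_layout /layout; set j := block _ _.
have start_gt0 : (0 < start j)%N.
  apply: (leq_trans _ (lead_le_start _ j)); apply: (leq_trans _ (prev_stop_le_lead _ j)).
  exact: leq_ltn_trans (leq0n _) (prev_stop_gt (@spacing_gt0 R p) j).
by rewrite leqNgt start_gt0 mulr0.
Qed.

Definition lp_seed : lp p1 := Lp lp_seed_pred.

(** The second half counts return times in a window starting at a return time,
    and takes window length t ^ 2 - 1, where sqrt (s + 1) = t. *)
Lemma lp_supercyclic_not_reiteratively :
  exists T : {linear l1sum (lp p1) R[i]^o -> l1sum (lp p1) R[i]^o},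
    [/\ bounded_operator T, supercyclic T & ~ reiteratively_supercyclic T].
Proof.
have [B BE BM] := lp_shift p1 (@root_weight_gt0 R p) (root_weight_step p1).
have iterB k (x : lp p1) n : iter k B x n = (W (n + k)%N / W n)%:C * x (n + k)%N.
  exact: (iter_shift (@root_weight_gt0 R p) BE).
exists (sum_id B); split.
- by apply: bounded_sum_id BM; rewrite ler1n.
- exists (lp_seed, 1) => U U0 oU.
  have [s [e [e0 eU]]] := return_times_target B lp_seed (word_lp_dense (root_weight_ge1 p1)) oU U0.
  have [i Ni irs] := @task_recurrent R 0 s (Num.truncn ((e / 2) `^ p)^-1).
  have fits_s : fits (R := R) i s by have := @task_fits R i; rewrite irs.
  suff /eU/return_times_sum_id[l Ul] : rnorm (iter (start i) B lp_seed - word_lp p1 W s) < e.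
    exists (l *: iter (start i) (sum_id B) (lp_seed, 1)); split.
      by rewrite iter_sum_id; exact: Ul.
    by exists l => //; exists (start i).
  apply: (@le_lt_trans _ _ (e / 2)); last by lra.
  apply: rnorm_lp_le => [|N]; first by rewrite divr_ge0 ?ltW.
  have hi : 2 * 2 ^- i.+1 <= (e / 2) `^ p.
    rewrite exprS invfM mulrA divff// mul1r -[leRHS]invrK lef_pV2 ?posrE ?exprn_gt0 ?invr_gt0 ?powR_gt0 ?divr_gt0//.
    rewrite ltW// (lt_le_trans (truncnS_gt _))// -natrX ler_nat.
    by apply: leq_trans (ltn_expl i (isT : (1 < 2)%N)); rewrite ltnS.
  apply: le_trans hi; apply: (power_sum_single_layout p1 (n := start i)).
  + by rewrite prev_stopS ltnW// start_lt_stop//; exact: spacing_gt0.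
  + move=> k; rewrite prev_stopS => ki.
    have -> : (iter (start i) B lp_seed - word_lp p1 W s) k =
        iter (start i) B lp_seed k - word W s k by [].
    rewrite iterB /= addnC /single_layout (layoutE (@spacing_gt0 R p) _ (leq_addr k _) ki).
    rewrite irs addKn mulrA -rmorphM/= mulrAC divff ?gt_eqF ?root_weight_gt0//.
    by rewrite mul1r subrr.
  + move=> k; rewrite prev_stopS => ki.
    have -> : (iter (start i) B lp_seed - word_lp p1 W s) k =
        iter (start i) B lp_seed k - word W s k by [].
    rewrite word_default ?subr0; last first.
      have /andP[si _] := fits_s; apply: (leq_trans si).
      apply: (leq_trans (@le_spacing R p i (start i))); move: ki; by rewrite /stop leq_add2l.
    rewrite iterB /= addnC mulrA -rmorphM/= mulrAC divff ?mul1r//.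
    by rewrite gt_eqF ?root_weight_gt0.
- move=> [[x c] zU].
  have y1 : 1 < normc (word_lp p1 W [:: (2, 0)] 0%N).
    have -> : word_lp p1 W [:: (2, 0)] 0%N = ((W 0%N)^-1)%:C * (ratr 2 +i* ratr 0) by [].
    by rewrite root_weight0 invr1 mul1r rmorph0 ratr_nat normc_real ger0_norm ?ltr1n.
  have [K [U [oU U0 retU]]] := sum_id_return_coordinate B
    (fun (x y : lp p1) n => erefl _) (fun a (x : lp p1) n => erefl _)
    (@normc_le_rnorm_lp _ _ p1) y1.
  have [d d0 dN] := upper_banach_density_gt0 (zU U oU U0).
  set E := return_times _ _ U in retU dN *.
  have E_ret n : E n -> normc c < W n * normc (x n) /\ rnorm (iter n B x) < K * normc c.
    by move=> /retU[]/=; rewrite iterB root_weight0 divr1 add0n normc_scale ?root_weight_gt0.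
  have [n0 En0] : exists n, E n.
    apply: contrapT => noE; have [k] := dN 1%N.
    rewrite /window_count count_in_set0 => [|n _ En]; last by apply: noE; exists n.
    by rewrite leNgt mulr1 d0.
  have Kc : 0 < K * normc c by exact: le_lt_trans (rnorm_ge0 _) (E_ret _ En0).2.
  have c0 : 0 < normc c.
    by rewrite lt_neqAle normc_ge0 andbT; apply: contraTneq Kc => <-; rewrite mulr0 ltxx.
  have K0 : 0 < K by move: Kc; rewrite pmulr_lgt0.
  have countE n s : E n -> (count_in E n (n + s))%:R <= K `^ p * sqrtS s.
    move=> En; have cp : 0 < normc c `^ p by exact: powR_gt0.
    have W0 m : 0 <= W m by exact/ltW/root_weight_gt0.
    have ysum : power_sum (p := p) (iter n B x) 0 s <= K `^ p * normc c `^ p.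
      rewrite -powRM ?(ltW K0) ?(ltW c0)//.
      apply: le_trans (power_sum_le_rnorm _ _) _.
      by apply: powR_le; [exact: ltW|exact: rnorm_ge0|exact: ltW (E_ret _ En).2].
    rewrite -ler_pdivrMr ?sqrtS_gt0// -(ler_pM2r cp); apply: le_trans ysum.
    rewrite count_inE addnC -{1}(add0n n) big_addn addnK natr_sum mulrAC -mulrA big_distrl /=.
    rewrite /power_sum !big_nat; apply: ler_sum => j /andP[_ js].
    case: (boolP ((j + n)%N \in E)) => [/set_mem Ejn|_]; last by rewrite mul0r powR_ge0.
    rewrite mul1r iterB normc_scale ?divr_gt0 ?root_weight_gt0//.
    rewrite mulrAC powRM ?invr_ge0 ?mulr_ge0 ?normc_ge0 ?W0//.
    rewrite -[(W j)^-1]powR_inv1 ?W0//.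
    rewrite -powRrM (mulrC (-1)) powRrM root_weightK// powR_inv1 ?(ltW (sqrtS_gt0 _))//.
    apply: ler_pM; rewrite ?(ltW cp) ?invr_ge0 ?(ltW (sqrtS_gt0 _))//.
      by apply: powR_le; [exact: ltW|exact: ltW|exact: ltW (E_ret _ Ejn).1].
    by rewrite lef_pV2 ?posrE ?sqrtS_gt0// sqrtS_le// ltnW.
  pose t := (Num.truncn (2 * K `^ p / d)).+2.
  have [k kt] := dN (t ^ 2).-1.
  suff : (window_count E (t ^ 2).-1 k)%:R < d * (t ^ 2).-1%:R by rewrite ltNge kt.
  have t0 : 0 < t%:R :> R by rewrite ltr0n.
  have sE : (t ^ 2).-1%:R = t%:R ^+ 2 - 1 :> R by rewrite -subn1 natrB ?expn_gt0// natrX.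
  have tK : 2 * K `^ p < d * t%:R.
    by rewrite [ltRHS]mulrC -ltr_pdivrMr// (lt_le_trans (truncnS_gt _))// ler_nat.
  have Kd : K `^ p * t%:R < d * (t ^ 2).-1%:R.
    rewrite sE.
    have : 2 * K `^ p * t%:R < d * t%:R * t%:R by rewrite ltr_pM2r.
    have : d * 2 <= d * t%:R ^+ 2.
      by rewrite ler_wpM2l ?(ltW d0)// -natrX ler_nat (@leq_trans (2 ^ 2))// leq_exp2r.
    by rewrite expr2 -!mulrA mulrBr mulr1 mulrA; lra.
  apply: le_lt_trans Kd; rewrite -(@sqrtS_square R t)//.
  rewrite /window_count; set L := (t ^ 2).-1.
  have [[n1 [kn1 En1]]|noE] := pselect (exists n, (k < n)%N /\ n \in E); last first.
    rewrite count_in_set0 ?mulr_ge0 ?powR_ge0 ?(ltW (sqrtS_gt0 _))// => i /andP[ki _] Ei.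
    by apply: noE; exists i; split=> //; rewrite mem_set.
  have exE : exists n, (k < n)%N && (n \in E) by exists n1; rewrite kn1.
  case: (ex_minnP exE) => m /andP[km /set_mem Em] mmin.
  apply: le_trans (countE _ L Em); rewrite ler_nat.
  have none a b : (k < a)%N -> (b <= m)%N -> count_in E a b = 0%N.
    move=> ka bm; apply: count_in_set0 => i /andP[ai ib] Ei.
    have := mmin i; rewrite (leq_trans ka ai) mem_set//= => /(_ isT).
    by rewrite leqNgt (leq_trans ib bm).
  have [ksm|mks] := leqP (k + L).+1 m; first by rewrite none.
  rewrite (@count_in_cat _ _ m) ?(ltnW mks)// none// add0n.
  rewrite (@count_in_cat _ m (k + L).+1 (m + L)) ?leq_addr ?(ltnW mks)//.
  by rewrite -addSn leq_add2r.
Qed.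
End lp_density.

Theorem corollary2p2 (R : realType) :
  [/\ exists T : {linear l1sum (c0 R) R[i]^o -> l1sum (c0 R) R[i]^o},
        [/\ bounded_operator T, U_frequently_supercyclic T
          & ~ frequently_supercyclic T],
      exists T : {linear l1sum (c0 R) R[i]^o -> l1sum (c0 R) R[i]^o},
        [/\ bounded_operator T, reiteratively_supercyclic T
          & ~ U_frequently_supercyclic T]
    & forall (p : R) (p1 : 1 <= p),
      exists T : {linear l1sum (lp p1) R[i]^o -> l1sum (lp p1) R[i]^o},
        [/\ bounded_operator T, supercyclic T
          & ~ reiteratively_supercyclic T]].
Proof.
split; first exact: c0_U_frequently_not_frequently.
  exact: c0_reiteratively_not_U_frequently.
by move=> p p1; exact: lp_supercyclic_not_reiteratively.
Qed.
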